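(* Let $R$ be a noetherian normal integral domain with fraction field $K$, and let $A$ be an $R$-algebra that is finitely generated and flat as an $R$-module and such that $A^K = K\otimes_R A$ is a split $K$-algebra. Then for every $\mathfrak{p}\in\operatorname{Spec}(R)$ the natural map $A_{\mathfrak{p}}\twoheadrightarrow A(\mathfrak{p})$ is block bijective, i.e. it induces a bijection between the block idempotents of $A_{\mathfrak{p}}$ and the block idempotents of $A(\mathfrak{p})$.
   Context: Rings are associative with identity. A block idempotent of a ring is a centrally-primitive idempotent, i.e. a primitive idempotent of its center. For $\mathfrak{p}\in\operatorname{Spec}(R)$, $A_{\mathfrak{p}}=R_{\mathfrak{p}}\otimes_R A$ is the localization, $\mathfrak{p}_{\mathfrak{p}}$ is the maximal ideal of $R_{\mathfrak p}$, $\mathrm{k}(\mathfrak{p})=\operatorname{Frac}(R/\mathfrak{p})$ is the residue field, and $A(\mathfrak{p})=\mathrm{k}(\mathfrak{p})\otimes_R A\simeq A_{\mathfrak{p}}/\mathfrak{p}_{\mathfrak{p}}A_{\mathfrak{p}}$ is the specialization (fiber). A finite-dimensional algebra over a field is split if all of its simple modules remain simple under every extension of the base field. *)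

(* Defs.v *)
From HB Require Import structures.
From mathcomp Require Import all_boot all_order all_algebra.
From mathcomp Require Import generic_quotient ring_quotient fraction.
From mathcomp Require Import boolp classical_sets functions.

Set Implicit Arguments.
Unset Strict Implicit.
Unset Printing Implicit Defensive.

Import GRing.Theory.
Local Open Scope ring_scope.
Local Open Scope quotient_scope.

Definition restr (R S : pzRingType) (f : {rmorphism R -> S}) (M : lmodType S)
  : Type := M.

Section Restr.
Variables (R S : pzRingType) (f : {rmorphism R -> S}) (M : lmodType S).

HB.instance Definition _ := GRing.Zmodule.copy (restr f M) M.

Definition restr_scale (r : R) (m : restr f M) : restr f M := f r *: (m : M).

Lemma restr_scaleA a b m :
  restr_scale a (restr_scale b m) = restr_scale (a * b) m.
Proof. by rewrite /restr_scale scalerA rmorphM. Qed.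
Lemma restr_scale1 : left_id 1 restr_scale.
Proof. by move=> m; rewrite /restr_scale rmorph1 scale1r. Qed.
Lemma restr_scaleDr : right_distributive restr_scale +%R.
Proof. by move=> r m n; rewrite /restr_scale scalerDr. Qed.
Lemma restr_scaleDl m : {morph restr_scale^~ m : a b / a + b}.
Proof. by move=> a b; rewrite /restr_scale rmorphD scalerDl. Qed.

HB.instance Definition _ := GRing.Zmodule_isLmodule.Build R (restr f M)
  restr_scaleA restr_scale1 restr_scaleDr restr_scaleDl.
End Restr.

Section Tensor.
Variables (R : comPzRingType) (M N : lmodType R).
Implicit Types (s t : seq (M * N)) (r : R) (m : M) (n : N).

(* The list [:: (m1, n1); ...; (mk, nk)] stands for the formal sum of the
   (mi, ni). No formal opposites are needed, as (- m, n) is an opposite of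
   (m, n) in the quotient. *)
Inductive tens_rel : seq (M * N) -> seq (M * N) -> Prop :=
| tens_refl s : tens_rel s s
| tens_sym s t : tens_rel s t -> tens_rel t s
| tens_trans s t u : tens_rel s t -> tens_rel t u -> tens_rel s u
| tens_cat s s' t t' :
    tens_rel s s' -> tens_rel t t' -> tens_rel (s ++ t) (s' ++ t')
| tens_comm s t : tens_rel (s ++ t) (t ++ s)
| tens_zero n : tens_rel [:: (0, n)] [::]
| tens_addl m m' n : tens_rel [:: (m + m', n)] [:: (m, n); (m', n)]
| tens_addr m n n' : tens_rel [:: (m, n + n')] [:: (m, n); (m, n')]
| tens_scale r m n : tens_rel [:: (r *: m, n)] [:: (m, r *: n)].

Definition tens_eqb : rel (seq (M * N)) := fun s t => `[< tens_rel s t >].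

Lemma tens_eqb_equiv : equiv_class_of tens_eqb.
Proof.
split.
- by move=> s; apply/asboolP; apply: tens_refl.
- by move=> s t; apply/asboolP/asboolP; apply: tens_sym.
- by move=> t s u /asboolP st /asboolP tu; apply/asboolP; apply: tens_trans tu.
Qed.

Canonical tens_equiv := EquivRelPack tens_eqb_equiv.

Definition tensor : Type := {eq_quot tens_equiv}.
HB.instance Definition _ : EqQuotient _ tens_equiv tensor :=
  EqQuotient.on tensor.
HB.instance Definition _ := Choice.on tensor.

Lemma tens_piP s t : (\pi_tensor s = \pi_tensor t) <-> tens_rel s t.
Proof.
split=> [/eqmodP/asboolP //|st].
by apply/eqmodP/asboolP.
Qed.

Lemma tens_repr s : tens_rel (repr (\pi_tensor s)) s.
Proof. by apply/tens_piP; rewrite reprK. Qed.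

Definition tens_opps s := [seq (- u.1, u.2) | u <- s].
Definition tensD (x y : tensor) : tensor := \pi_tensor (repr x ++ repr y).
Definition tensN (x : tensor) : tensor := \pi_tensor (tens_opps (repr x)).
Definition tens0 : tensor := \pi_tensor [::].

Lemma tensD_pi s t : tensD (\pi_tensor s) (\pi_tensor t) = \pi_tensor (s ++ t).
Proof. by apply/tens_piP; apply: tens_cat; apply: tens_repr. Qed.

Lemma tensDA : associative tensD.
Proof.
elim/quotW=> s; elim/quotW=> t; elim/quotW=> u.
by rewrite (tensD_pi t u) (tensD_pi s t) !tensD_pi catA.
Qed.

Lemma tensDC : commutative tensD.
Proof.
elim/quotW=> s; elim/quotW=> t.
by rewrite !tensD_pi; apply/tens_piP; apply: tens_comm.
Qed.

Lemma tens0D : left_id tens0 tensD.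
Proof. by elim/quotW=> s; rewrite tensD_pi. Qed.

Lemma tens_oppsD s : tens_rel (tens_opps s ++ s) [::].
Proof.
elim: s => [|[m n] s IHs] /=; first exact: tens_refl.
rewrite -cat1s -[(m, n) :: s]cat1s catA.
apply: (@tens_trans _ ([:: (- m, n)] ++ ([:: (m, n)] ++ tens_opps s) ++ s)).
  rewrite -!catA; apply: tens_cat; first exact: tens_refl.
  by rewrite !catA; apply: tens_cat; [exact: tens_comm | exact: tens_refl].
apply: (@tens_cat [:: (- m, n); (m, n)] [::] _ [::]) => //.
apply: (@tens_trans _ [:: (- m + m, n)]).
  by apply: tens_sym; apply: tens_addl.
by rewrite addNr; apply: tens_zero.
Qed.

Lemma tensND : left_inverse tens0 tensN tensD.
Proof.
move=> x; rewrite -{2}[x]reprK tensD_pi; apply/tens_piP; exact: tens_oppsD.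
Qed.

HB.instance Definition _ :=
  GRing.isZmodule.Build tensor tensDA tensDC tens0D tensND.

Definition tens m n : tensor := \pi_tensor [:: (m, n)].

Lemma tensDl m m' n : tens (m + m') n = tens m n + tens m' n.
Proof.
rewrite [RHS]tensD_pi; apply/tens_piP; exact: tens_addl.
Qed.

Lemma tensDr m n n' : tens m (n + n') = tens m n + tens m n'.
Proof.
rewrite [RHS]tensD_pi; apply/tens_piP; exact: tens_addr.
Qed.

Lemma tensZ r m n : tens (r *: m) n = tens m (r *: n).
Proof. by apply/tens_piP; apply: tens_scale. Qed.

Lemma tens_pi s : \pi_tensor s = \sum_(u <- s) tens u.1 u.2.
Proof.
elim: s => [|[m n] s IHs]; first by rewrite big_nil.
by rewrite big_cons -IHs -cat1s -tensD_pi.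
Qed.

Lemma tens_ind (P : tensor -> Prop) :
  (forall m n, P (tens m n)) -> (forall x y, P x -> P y -> P (x + y)) ->
  forall x, P x.
Proof.
move=> Pt PD; elim/quotW; elim=> [|[m n] s IHs].
  rewrite (_ : \pi_tensor [::] = tens 0 0) //.
  by apply/tens_piP/tens_sym/tens_zero.
by rewrite -cat1s -tensD_pi; apply: PD => //; apply: Pt.
Qed.

Definition balanced (P : zmodType) (f : M -> N -> P) :=
  [/\ forall m m' n, f (m + m') n = f m n + f m' n,
      forall m n n', f m (n + n') = f m n + f m n' &
      forall r m n, f (r *: m) n = f m (r *: n)].

(* The additive map induced by f, independent of the representative when f is
   balanced. *)
Definition tens_lift (P : zmodType) (f : M -> N -> P) (x : tensor) : P :=
  \sum_(u <- repr x) f u.1 u.2.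

Section Lift.
Variables (P : zmodType) (f : M -> N -> P) (fP : balanced f).

Lemma tens_rel_sum s t : tens_rel s t ->
  \sum_(u <- s) f u.1 u.2 = \sum_(u <- t) f u.1 u.2.
Proof.
have [fDl fDr fZ] := fP.
elim=> {s t} //.
- by move=> s t u _ -> _ ->.
- by move=> s s' t t' _ e1 _ e2; rewrite !big_cat e1 e2.
- by move=> s t; rewrite !big_cat /= addrC.
- move=> n; rewrite big_seq1 big_nil /=.
  by apply: (addrI (f 0 n)); rewrite -fDl !addr0.
- by move=> m m' n; rewrite !big_cons !big_nil /= !addr0 fDl.
- by move=> m n n'; rewrite !big_cons !big_nil /= !addr0 fDr.
- by move=> r m n; rewrite !big_seq1 fZ.
Qed.

Lemma tens_liftE m n : tens_lift f (tens m n) = f m n.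
Proof. by rewrite /tens_lift (tens_rel_sum (tens_repr _)) big_seq1. Qed.

Lemma tens_liftD x y : tens_lift f (x + y) = tens_lift f x + tens_lift f y.
Proof.
by rewrite /tens_lift -big_cat; apply/tens_rel_sum/tens_repr.
Qed.

End Lift.
End Tensor.

Section TensorMap.
Variables (R : comPzRingType) (M N M' N' : lmodType R).
Variables (g : {linear M -> M'}) (h : {linear N -> N'}).

Definition tens_map : tensor M N -> tensor M' N' :=
  tens_lift (fun m n => tens (g m) (h n)).

Lemma tens_map_balanced : balanced (fun m n => tens (g m) (h n)).
Proof.
split=> *; by rewrite ?(raddfD g) ?(raddfD h) ?tensDl ?tensDr // !linearZ tensZ.
Qed.

Lemma tens_mapE m n : tens_map (tens m n) = tens (g m) (h n).
Proof. exact: tens_liftE tens_map_balanced m n. Qed.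
End TensorMap.

Definition idlin (R : pzRingType) (M : lmodType R) : {linear M -> M} :=
  @idfun M.

Definition flat (R : comPzRingType) (M : lmodType R) : Prop :=
  forall (N N' : lmodType R) (h : {linear N -> N'}),
    injective h -> injective (tens_map (idlin M) h).

Definition fin_gen (R : pzRingType) (M : lmodType R) (S : {pred M}) : Prop :=
  exists s : seq M, forall x : M,
    x \in S <-> exists c : nat -> R, x = \sum_(i < size s) c i *: s`_i.

Definition fin_gen_module (R : pzRingType) (M : lmodType R) : Prop :=
  fin_gen (predT : {pred M}).

Definition noetherian (R : comPzRingType) : Prop :=
  forall I : {pred R^o}, GRing.submod_closed I -> fin_gen I.

Definition normal_domain (R : idomainType) : Prop :=
  forall x : {fraction R},
    integralOver (@tofrac R) x -> exists r : R, x = tofrac r.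

(* The library's algType excludes the zero ring, and a base change of a nonzero
   algebra can be zero. *)
Record algebra (R : comPzRingType) := Algebra {
  alg_ring :> pzRingType;
  alg_map : {rmorphism R -> alg_ring};
  alg_central : forall r (a : alg_ring), alg_map r * a = a * alg_map r
}.

Definition alg_mod (R : comPzRingType) (A : algebra R) : lmodType R :=
  restr (alg_map A) A^o.

Section BaseChange.
Variables (R S : comPzRingType) (f : {rmorphism R -> S}).

Definition base_change (M : lmodType R) : Type := tensor (restr f S^o) M.

HB.instance Definition _ M :=
  GRing.Zmodule.copy (base_change M) (tensor (restr f S^o) M).

Variable A : algebra R.

Local Notation bc M := (base_change (restr (alg_map A) M)).
Local Notation pure M s m :=
  (@tens R (restr f S^o) (restr (alg_map A) M) s m).

Section Act.
Variable M : lmodType A.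

Definition bc_act1 (s : S) (a : A) : bc M -> bc M :=
  tens_lift (fun (t : restr f S^o) (m : restr (alg_map A) M) =>
    pure M (s * (t : S)) (a *: (m : M)) : bc M).

Definition bc_act (x : bc A^o) (y : bc M) : bc M :=
  tens_lift
    (fun (s : restr f S^o) (a : restr (alg_map A) A^o) => bc_act1 s a y) x.

Lemma bc_act1_balanced s a : balanced
  (fun (t : restr f S^o) (m : restr (alg_map A) M) =>
     pure M (s * (t : S)) (a *: (m : M)) : bc M).
Proof.
split=> [t t' m|t m m'|r t m].
- by rewrite mulrDr tensDl.
- by rewrite scalerDr tensDr.
- rewrite -[in LHS]/(f r * t) mulrCA (tensZ r (s * t : restr f S^o)).
  by rewrite -![r *: _]/(alg_map A r *: _) !scalerA alg_central.
Qed.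

Lemma bc_act1E s a t m : bc_act1 s a (pure M t m) = pure M (s * t) (a *: m).
Proof. exact: (tens_liftE (bc_act1_balanced s a)). Qed.

Lemma bc_act1D s a y z : bc_act1 s a (y + z) = bc_act1 s a y + bc_act1 s a z.
Proof. exact: (tens_liftD (bc_act1_balanced s a)). Qed.

Lemma bc_act_balanced y : balanced
  (fun (s : restr f S^o) (a : restr (alg_map A) A^o) => bc_act1 s a y).
Proof.
split=> [s s' a|s a a'|r s a]; elim/tens_ind: y => [t m|y z IHy IHz].
- by rewrite !bc_act1E mulrDl tensDl.
- by rewrite !bc_act1D IHy IHz addrACA.
- by rewrite !bc_act1E scalerDl tensDr.
- by rewrite !bc_act1D IHy IHz addrACA.
- rewrite !bc_act1E -[r *: s]/(f r * s) -[r *: a]/(alg_map A r * a) -mulrA.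
  by rewrite (tensZ r (s * t : restr f S^o)) -scalerA.
- by rewrite !bc_act1D IHy IHz.
Qed.

Lemma bc_actE s a t m : 
  bc_act (pure A^o s a) (pure M t m) = pure M (s * t) ((a : A) *: (m : M)).
Proof. by rewrite /bc_act (tens_liftE (bc_act_balanced _)) bc_act1E. Qed.

Lemma bc_actDl x x' y : bc_act (x + x') y = bc_act x y + bc_act x' y.
Proof. exact: (tens_liftD (bc_act_balanced y)). Qed.

Lemma bc_actDr x y z : bc_act x (y + z) = bc_act x y + bc_act x z.
Proof.
elim/tens_ind: x => [s a|x x' IHx IHx'].
  by rewrite /bc_act !(tens_liftE (bc_act_balanced _)) bc_act1D.
by rewrite !bc_actDl IHx IHx' addrACA.
Qed.

Lemma bc_act_1 y : bc_act (pure A^o 1 1) y = y.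
Proof.
elim/tens_ind: y => [t m|y z IHy IHz]; last by rewrite bc_actDr IHy IHz.
by rewrite bc_actE mul1r scale1r.
Qed.
End Act.

Lemma bc_actA (M : lmodType A) (x y : bc A^o) (z : bc M) :
  bc_act x (bc_act y z) = bc_act (bc_act x y) z.
Proof.
elim/tens_ind: x => [s a|x x' IHx IHx']; last by rewrite !bc_actDl IHx IHx'.
elim/tens_ind: y => [t b|y y' IHy IHy'].
  elim/tens_ind: z => [u m|z z' IHz IHz']; last by rewrite !bc_actDr IHz IHz'.
  by rewrite !bc_actE mulrA scalerA.
by rewrite bc_actDr !bc_actDl bc_actDr IHy IHy'.
Qed.

Lemma bc_act1r (x : bc A^o) : bc_act x (pure A^o 1 1) = x.
Proof.
elim/tens_ind: x => [s a|x x' IHx IHx']; last by rewrite !bc_actDl IHx IHx'.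
by rewrite bc_actE mulr1 -[_ *: _]/(a * 1 : A) mulr1.
Qed.

Definition bc_ring : Type := bc A^o.

HB.instance Definition _ := GRing.Zmodule.copy bc_ring (bc A^o).
HB.instance Definition _ := GRing.Zmodule_isPzRing.Build bc_ring
  (@bc_actA A^o) (@bc_act_1 A^o) bc_act1r
  (fun x y z => @bc_actDl A^o x y z) (@bc_actDr A^o).

Definition bc_mod (M : lmodType A) : Type := bc M.

HB.instance Definition _ M := GRing.Zmodule.copy (bc_mod M) (bc M).
HB.instance Definition _ M := GRing.Zmodule_isLmodule.Build bc_ring (bc_mod M)
  (@bc_actA M) (@bc_act_1 M) (@bc_actDr M) (fun y x x' => @bc_actDl M x x' y).

Definition bc_map (s : S) : bc_ring := pure A^o s 1.

Lemma bc_map_zmod : zmod_morphism bc_map.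
Proof.
move=> s t; apply: (addIr (bc_map t)); rewrite subrK.
by rewrite -[LHS](tensDl (M := restr f S^o)) subrK.
Qed.

Lemma bc_map_monoid : monoid_morphism bc_map.
Proof.
split=> // s t; rewrite [RHS](@bc_actE A^o).
by rewrite -[_ *: _]/(1 * 1 : A) mulr1.
Qed.

HB.instance Definition _ := GRing.isZmodMorphism.Build S bc_ring bc_map
  bc_map_zmod.
HB.instance Definition _ := GRing.isMonoidMorphism.Build S bc_ring bc_map
  bc_map_monoid.

Lemma bc_map_central (s : S) (x : bc_ring) : bc_map s * x = x * bc_map s.
Proof.
elim/tens_ind: x => [t a|x y IHx IHy]; last by rewrite mulrDr mulrDl IHx IHy.
rewrite [LHS](@bc_actE A^o) [RHS](@bc_actE A^o) mulrC.
by rewrite -![_ *: _]/(_ * _ : A) mul1r mulr1.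
Qed.

Definition bc_alg : algebra S := Algebra bc_map_central.
End BaseChange.

Lemma frac_numden (D : idomainType) (k : {fraction D}) :
  exists n d : D, d != 0 /\ k = tofrac n / tofrac d.
Proof.
elim/quotW: k => x; exists (\n_x), (\d_x); split; first exact: denom_ratioP.
apply: (canRL (mulfK _)); first by rewrite tofrac_eq0 denom_ratioP.
rewrite !piE; apply/eqmodP; rewrite /= FracField.equivfE /FracField.mulf.
by rewrite !numden_Ratio ?mulr1 ?oner_eq0 ?denom_ratioP // mulrC.
Qed.

Section SpecializationMap.
Variables (R : idomainType) (p : prime_idealr R).

Definition in_loc : {pred {fraction R}} := fun x =>
  `[< exists a s : R, s \notin p /\ x = tofrac a / tofrac s >].

Lemma in_locP (x : {fraction R}) :
  reflect (exists a s : R, s \notin p /\ x = tofrac a / tofrac s)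
          (x \in in_loc).
Proof. exact: asboolP. Qed.

Lemma notin_prime_neq0 s : s \notin p -> s != 0.
Proof. by apply: contraNneq => ->; apply: idealr0. Qed.

Lemma notin_primeM s t : s \notin p -> t \notin p -> s * t \notin p.
Proof. by move=> sp tp; rewrite prime_idealrM negb_or sp. Qed.

Lemma in_loc_subring : subring_closed in_loc.
Proof.
split.
- apply/in_locP; exists 1, 1; rewrite idealr1; split=> //.
  by rewrite rmorph1 divr1.
- move=> _ _ /in_locP[a [s [sp ->]]] /in_locP[b [t [tp ->]]].
  apply/in_locP; exists (a * t - b * s), (s * t); split.
    exact: notin_primeM.
  rewrite -mulNr addf_div ?tofrac_eq0 ?notin_prime_neq0 //.
  by rewrite rmorphB !rmorphM mulNr.
- move=> _ _ /in_locP[a [s [sp ->]]] /in_locP[b [t [tp ->]]].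
  apply/in_locP; exists (a * b), (s * t); split; first exact: notin_primeM.
  by rewrite !rmorphM mulf_div.
Qed.

HB.instance Definition _ :=
  GRing.isSubringClosed.Build {fraction R} in_loc in_loc_subring.

(* As R is a domain, R_p is the subring of the a / s with s outside p. *)
Record localization := Localization {
  loc_val :> {fraction R};
  loc_valP : loc_val \in in_loc
}.

HB.instance Definition _ := [isSub for loc_val].
HB.instance Definition _ := [Choice of localization by <:].
HB.instance Definition _ :=
  [SubChoice_isSubComNzRing of localization by <:].

Lemma to_loc_subproof (r : R) : tofrac r \in in_loc.
Proof.
apply/in_locP; exists r, 1; rewrite idealr1; split=> //.
by rewrite rmorph1 divr1.
Qed.

Definition to_loc (r : R) : localization := Localization (to_loc_subproof r).

Lemma to_loc_zmod : zmod_morphism to_loc.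
Proof. by move=> r s; apply/val_inj; rewrite /= rmorphB. Qed.

Lemma to_loc_monoid : monoid_morphism to_loc.
Proof.
by split=> [|r s]; apply/val_inj; rewrite /= ?rmorph1 ?rmorphM.
Qed.

HB.instance Definition _ :=
  GRing.isZmodMorphism.Build R localization to_loc to_loc_zmod.
HB.instance Definition _ :=
  GRing.isMonoidMorphism.Build R localization to_loc to_loc_monoid.

Definition res_dom : Type := {ideal_quot p}.
HB.instance Definition _ := GRing.ComNzRing.copy res_dom {ideal_quot p}.

Definition res_unit : pred res_dom := fun x => `[< exists y, y * x = 1 >].
Definition res_inv (x : res_dom) : res_dom :=
  if pselect (exists y, y * x = 1) is left h then projT1 (cid h) else x.

Lemma res_mulVx : {in res_unit, left_inverse 1 res_inv *%R}.
Proof.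
move=> x /asboolP ux; rewrite /res_inv; case: pselect => // h.
exact: (projT2 (cid h)).
Qed.

Lemma res_unitPl x y : y * x = 1 -> res_unit x.
Proof. by move=> yx; apply/asboolP; exists y. Qed.

Lemma res_invx_out : {in [predC res_unit], res_inv =1 id}.
Proof.
move=> x /negP nux; rewrite /res_inv; case: pselect => // h.
by case: nux; apply/asboolP.
Qed.

HB.instance Definition _ := GRing.ComNzRing_hasMulInverse.Build res_dom
  res_mulVx res_unitPl res_invx_out.
HB.instance Definition _ := GRing.ComUnitRing_isIntegral.Build res_dom
  (@Quotient.rquot_IdomainAxiom R p).

Definition res_field : fieldType := {fraction res_dom}.

Definition to_res (r : R) : res_field :=
  tofrac (\pi_({ideal_quot p}) r : res_dom).

Lemma to_res_zmod : zmod_morphism to_res.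
Proof. by move=> r s; rewrite /to_res rmorphB -[in RHS]rmorphB. Qed.

Lemma to_res_monoid : monoid_morphism to_res.
Proof.
by split=> [|r s]; rewrite /to_res ?(rmorph1, rmorphM) // -?[in RHS]rmorphM.
Qed.

HB.instance Definition _ :=
  GRing.isZmodMorphism.Build R res_field to_res to_res_zmod.
HB.instance Definition _ :=
  GRing.isMonoidMorphism.Build R res_field to_res to_res_monoid.

Lemma to_res_eq0 r : (to_res r == 0) = (r \in p).
Proof.
by rewrite tofrac_eq0 -[_ == 0]/(\pi_({ideal_quot p}) r == 0)
   -(rmorph0 \pi_({ideal_quot p})) -Quotient.idealrBE subr0.
Qed.

Lemma loc_frac (x : localization) :
  exists u : R * R, u.2 \notin p /\ val x = tofrac u.1 / tofrac u.2.
Proof.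
by case: x => x /= /in_locP[a [s sP]]; exists (a, s).
Qed.

Definition loc_to_res (x : localization) : res_field :=
  let u := projT1 (cid (loc_frac x)) in to_res u.1 / to_res u.2.

Lemma loc_to_resE (x : localization) (a s : R) : s \notin p ->
  val x = tofrac a / tofrac s -> loc_to_res x = to_res a / to_res s.
Proof.
move=> sp xas; rewrite /loc_to_res; case: (cid _) => -[b t] /= [tp].
rewrite xas => /eqP; rewrite eqr_div ?tofrac_eq0 ?notin_prime_neq0 //.
rewrite -!rmorphM tofrac_eq => /eqP e.
by apply/eqP; rewrite eqr_div ?to_res_eq0 // -!rmorphM e.
Qed.

Lemma loc_to_res_zmod : zmod_morphism loc_to_res.
Proof.
move=> x y; have [[a s] /= [sp xE]] := loc_frac x.
have [[b t] /= [tp yE]] := loc_frac y.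
rewrite (loc_to_resE sp xE) (loc_to_resE tp yE).
rewrite (@loc_to_resE _ (a * t - b * s) (s * t)) ?notin_primeM //.
  by rewrite -[in RHS]mulNr addf_div ?to_res_eq0 // rmorphB !rmorphM mulNr.
rewrite /= xE yE -mulNr addf_div ?tofrac_eq0 ?notin_prime_neq0 //.
by rewrite rmorphB !rmorphM mulNr.
Qed.

Lemma loc_to_res_monoid : monoid_morphism loc_to_res.
Proof.
split=> [|x y].
  rewrite (@loc_to_resE _ 1 1) ?idealr1 ?rmorph1 ?divr1 //.
have [[a s] /= [sp xE]] := loc_frac x.
have [[b t] /= [tp yE]] := loc_frac y.
rewrite (loc_to_resE sp xE) (loc_to_resE tp yE).
rewrite (@loc_to_resE _ (a * b) (s * t)) ?notin_primeM //.
  by rewrite !rmorphM mulf_div.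
by rewrite /= xE yE !rmorphM mulf_div.
Qed.

HB.instance Definition _ :=
  GRing.isZmodMorphism.Build localization res_field loc_to_res loc_to_res_zmod.
HB.instance Definition _ :=
  GRing.isMonoidMorphism.Build localization res_field loc_to_res
    loc_to_res_monoid.

Lemma loc_to_res_surj (k : res_field) : exists x, loc_to_res x = k.
Proof.
have [n [d [d0 ->]]] := frac_numden k.
move: n d d0; elim/quotW=> a; elim/quotW=> s s0.
have sp : s \notin p by rewrite -to_res_eq0 tofrac_eq0.
have xP : tofrac a / tofrac s \in in_loc by apply/in_locP; exists a, s.
by exists (Localization xP); rewrite (@loc_to_resE _ a s).
Qed.

Lemma loc_to_res_to_loc r : loc_to_res (to_loc r) = to_res r.
Proof.
by rewrite (@loc_to_resE _ r 1) ?idealr1 ?rmorph1 ?divr1.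
Qed.

Variable A : algebra R.

Definition alg_loc : algebra localization := bc_alg to_loc A.
Definition alg_fiber : algebra res_field := bc_alg to_res A.

Definition specialization : alg_loc -> alg_fiber :=
  tens_lift (fun (x : restr to_loc localization^o) (a : alg_mod A) =>
    @tens R (restr to_res res_field^o) (alg_mod A) (loc_to_res x) a
      : alg_fiber).

Lemma specialization_balanced : balanced
  (fun (x : restr to_loc localization^o) (a : alg_mod A) =>
    @tens R (restr to_res res_field^o) (alg_mod A) (loc_to_res x) a
      : alg_fiber).
Proof.
split=> [x y a|x a b|r x a].
- by rewrite rmorphD [LHS](@tensDl R (restr to_res res_field^o)).
- by rewrite [LHS](@tensDr R (restr to_res res_field^o)).
- rewrite -[r *: x]/(to_loc r * x) rmorphM /= loc_to_res_to_loc.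
  exact: (@tensZ R (restr to_res res_field^o) (alg_mod A) r (loc_to_res x) a).
Qed.

Lemma specializationE (x : localization) (a : A) :
  specialization (@tens R (restr to_loc localization^o) (alg_mod A) x a) =
  @tens R (restr to_res res_field^o) (alg_mod A) (loc_to_res x) a.
Proof. exact: (tens_liftE specialization_balanced). Qed.

Lemma specialization_zmod : zmod_morphism specialization.
Proof.
move=> x y; apply: (addIr (specialization y)); rewrite subrK.
by rewrite -[LHS](tens_liftD specialization_balanced) subrK.
Qed.

Lemma specialization_monoid : monoid_morphism specialization.
Proof.
split; first by rewrite [LHS]specializationE rmorph1.
have sD u v : specialization (u + v) = specialization u + specialization v.
  exact: (tens_liftD specialization_balanced).
move=> x y; elim/tens_ind: x => [s a|x x' IHx IHx'].
  elim/tens_ind: y => [t b|y y' IHy IHy'].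
    rewrite [X in specialization X](@bc_actE _ _ to_loc A A^o) !specializationE.
    by rewrite [RHS](@bc_actE _ _ to_res A A^o) rmorphM.
  by rewrite [in LHS]mulrDr !sD mulrDr IHy IHy'.
by rewrite [in LHS]mulrDl !sD mulrDl IHx IHx'.
Qed.

HB.instance Definition _ :=
  GRing.isZmodMorphism.Build alg_loc alg_fiber specialization
    specialization_zmod.
HB.instance Definition _ :=
  GRing.isMonoidMorphism.Build alg_loc alg_fiber specialization
    specialization_monoid.

Lemma specialization_surj (y : alg_fiber) : exists x, specialization x = y.
Proof.
elim/tens_ind: y => [k a|_ _ [x <-] [x' <-]]; last first.
  by exists (x + x'); rewrite rmorphD.
have [x <-] := loc_to_res_surj k.
exists (tens (x : restr to_loc localization^o) a).
exact: specializationE.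
Qed.
End SpecializationMap.
Arguments specialization {R} p A _.

Definition simple_module (B : pzRingType) (M : lmodType B) : Prop :=
  (exists x : M, x != 0) /\
  forall S : {pred M}, GRing.submod_closed S ->
    S =i pred1 (0 : M) \/ S =i predT.

Definition split_algebra (K : fieldType) (B : algebra K) : Prop :=
  forall (M : lmodType B), simple_module M ->
  forall (L : fieldType) (f : {rmorphism K -> L}), simple_module (bc_mod f M).

Section Blocks.
Local Open Scope classical_set_scope.

Definition central_idempotent (B : pzRingType) (e : B) : Prop :=
  e * e = e /\ forall b : B, e * b = b * e.

Definition block_idempotent (B : pzRingType) : set B :=
  [set e : B | [/\ central_idempotent e, e != 0 &
     forall e1 e2 : B, central_idempotent e1 -> central_idempotent e2 ->
       e1 * e2 = 0 -> e = e1 + e2 -> e1 = 0 \/ e2 = 0]].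

Definition block_bijective (B C : pzRingType) (phi : {rmorphism B -> C}) :=
  set_bij (@block_idempotent B) (@block_idempotent C) phi.
End Blocks.

(* Main.v *)
(* Let O be the localization R_p, m its maximal ideal, B = A_p, C = A(p) and
   D = A^K; flatness makes B a subring of D. By Nakayama's lemma, central
   idempotents of B are determined by their images in C, and any idempotent of
   B with central image is central, so one has to lift a central idempotent of
   C to some idempotent of B. Let a in B be any lift. For x, y in B the elements
   [a, x] and (a^2 - a) y lie in mB. If S is a simple D-module and L a field
   containing the eigenvalues of a on S, then L (x) S is simple, and applying a
   left and a right eigenvector to these relations shows that all differences
   of eigenvalues, and all values of t^2 - t at eigenvalues, are integral over
   m. As O is normal, the characteristic polynomial of a on S has coefficients
   in O and reduces to X^d or (X - 1)^d modulo m. Multiplying over the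
   composition factors of D yields monic g, h over O with g(a) h(a) = 0, g = X^i
   and h = (X - 1)^l modulo m. These are comaximal, so the polynomials in a
   contain an idempotent lifting the given one. *)
From HB Require Import structures.
Require Import Defs.
From mathcomp Require Import all_boot all_order all_algebra all_field.
From mathcomp Require Import generic_quotient ring_quotient fraction.
From mathcomp Require Import ring.
From mathcomp Require Import boolp classical_sets.

Set Implicit Arguments.
Unset Strict Implicit.
Unset Printing Implicit Defensive.

Import GRing.Theory.
Local Open Scope ring_scope.

(** * Block idempotents and central idempotents *)

Lemma central_idem0 (B : pzRingType) : central_idempotent (0 : B).
Proof. by split=> [|b]; rewrite !(mul0r, mulr0). Qed.

Lemma central_idemM (B : pzRingType) (e f : B) :
  central_idempotent e -> central_idempotent f -> central_idempotent (e * f).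
Proof.
move=> [ee ce] [ff cf]; split=> [|b].
  by rewrite mulrA -[e * f * e]mulrA cf mulrA ee -mulrA ff.
by rewrite -mulrA cf mulrA ce mulrA.
Qed.

Lemma central_idemC (B : pzRingType) (e : B) :
  central_idempotent e -> central_idempotent (1 - e).
Proof.
move=> [ee ce]; split=> [|b].
  by rewrite mulrBl mul1r mulrBr mulr1 ee subrr subr0.
by rewrite mulrBl mulrBr mul1r mulr1 ce.
Qed.

Lemma central_idemD (B : pzRingType) (e f : B) :
  central_idempotent e -> central_idempotent f -> e * f = 0 ->
  central_idempotent (e + f).
Proof.
move=> [ee ce] [ff cf] ef0; split=> [|b].
  by rewrite mulrDl !mulrDr ee ff -(ce f) ef0 addr0 add0r.
by rewrite mulrDl mulrDr ce cf.
Qed.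

Section CentralIdempotents.
Variables (B C : pzRingType) (phi : {rmorphism B -> C}).
Hypothesis phi_surj : forall y, exists x, phi x = y.
Hypothesis phi_inj : forall e f : B, central_idempotent e ->
  central_idempotent f -> phi e = phi f -> e = f.
Hypothesis phi_lift : forall y : C, central_idempotent y ->
  exists2 x, central_idempotent x & phi x = y.

Lemma central_idem_image e : central_idempotent e -> central_idempotent (phi e).
Proof.
move=> [ee ce]; split=> [|y]; first by rewrite -rmorphM ee.
by have [x <-] := phi_surj y; rewrite -!rmorphM ce.
Qed.

Lemma central_idem_eq0 e : central_idempotent e -> phi e = 0 -> e = 0.
Proof.
by move=> ce e0; apply: phi_inj => //; [exact: central_idem0 | rewrite rmorph0].
Qed.

(** Blocks are the nonzero central idempotents without a nontrivial orthogonal decomposition, and a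
    bijection on central idempotents transfers decompositions both ways. Lifts of orthogonal central
    idempotents are orthogonal: their product is a central idempotent killed by [phi], hence
    zero. *)
Lemma block_bijective_of_central_idem : block_bijective phi.
Proof.
split.
- move=> e [ce e0 eP]; split.
  + exact: central_idem_image.
  + by apply: contra_neq e0; exact: central_idem_eq0.
  + move=> _ _ /phi_lift[f1 cf1 <-] /phi_lift[f2 cf2 <-].
    rewrite -rmorphM => f12 eE.
    have f12_0 := central_idem_eq0 (central_idemM cf1 cf2) f12.
    have /eP[|||->|->] // : e = f1 + f2; rewrite ?rmorph0; auto.
    by apply: phi_inj => //; [exact: central_idemD | rewrite rmorphD].
- move=> e f; rewrite !inE => -[ce _ _] [cf _ _]; exact: phi_inj.
- move=> y [cy y0 yP]; have [e ce phie] := phi_lift cy.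
  exists e => //; split=> //.
    by apply: contra_neq y0 => e0; rewrite -phie e0 rmorph0.
  move=> e1 e2 ce1 ce2 e12 eE.
  have [] : phi e1 = 0 \/ phi e2 = 0.
  - apply: yP; [exact: central_idem_image | exact: central_idem_image | |].
      by rewrite -rmorphM e12 rmorph0.
    by rewrite -phie eE rmorphD.
  - by move/(central_idem_eq0 ce1); left.
  - by move/(central_idem_eq0 ce2); right.
Qed.
End CentralIdempotents.

(** * Algebras over a local ring *)

(** Multiply the system by the adjugate. Only the coefficients have to commute with each other, so
    [v] may live in a noncommutative ring. *)
Lemma det_mul_eq0 (O : comPzRingType) (B : pzRingType) (iota : {rmorphism O -> B})
    m (M : 'M[O]_m) (v : 'I_m -> B) :
  (forall i, \sum_j iota (M i j) * v j = 0) ->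
  forall i, iota (\det M) * v i = 0.
Proof.
move=> Mv i; transitivity (\sum_j iota ((\adj M *m M) i j) * v j).
  rewrite mul_adj_mx (bigD1 i) //= mxE eqxx big1 ?addr0 // => j ji.
  by rewrite mxE eq_sym (negPf ji) rmorph0 mul0r.
under eq_bigr => j _ do rewrite mxE rmorph_sum big_distrl /=.
rewrite exchange_big big1 // => l _.
under eq_bigr => j _ do rewrite rmorphM -mulrA.
by rewrite -big_distrr /= Mv mulr0.
Qed.

Section LocalAlgebra.
Variables (O : comNzRingType) (k : fieldType) (res : {rmorphism O -> k}).
Hypothesis res_unit : forall c, res c != 0 -> exists d, d * c = 1.
Variables (B : algebra O) (n : nat) (b : 'I_n -> B).
Hypothesis b_span :
  forall x, exists c : 'I_n -> O, x = \sum_i alg_map B (c i) * b i.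
Variables (C : pzRingType) (phi : {rmorphism B -> C}).
Hypothesis phi_ker : forall x, phi x = 0 ->
  exists2 c : 'I_n -> O, (forall i, res (c i) = 0)
    & x = \sum_i alg_map B (c i) * b i.

(** By [res_unit], [O] is local with maximal ideal the kernel of [res]. The determinant of [1 - P]
    reduces to 1, so it is a unit, and it annihilates every [v i]. *)
Lemma nakayama m (P : 'M[O]_m) (v : 'I_m -> B) :
  (forall i j, res (P i j) = 0) ->
  (forall i, v i = \sum_j alg_map B (P i j) * v j) -> forall i, v i = 0.
Proof.
move=> P0 vP i; pose M := 1%:M - P.
have Mv j : \sum_l alg_map B (M j l) * v l = 0.
  under eq_bigr => l _ do rewrite !mxE rmorphB mulrBl.
  rewrite sumrB -vP (bigD1 j) //= eqxx rmorph1 mul1r big1 ?addr0 ?subrr //.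
  by move=> l lj; rewrite eq_sym (negPf lj) rmorph0 mul0r.
have [] := @res_unit (\det M).
  rewrite -det_map_mx (_ : map_mx res M = 1%:M) ?det1 ?oner_eq0 //.
  apply/matrixP=> j l; rewrite !mxE rmorphB P0 subr0.
  by rewrite rmorph_nat.
move=> d dM; have := det_mul_eq0 Mv i => /(congr1 ( *%R (alg_map B d))).
by rewrite mulrA -rmorphM dM rmorph1 mul1r mulr0.
Qed.

(** Each [f * b i * h] lies in mB. Multiplying by [f] and [h] once more expresses it through the
    same family with coefficients in the maximal ideal, so Nakayama's lemma applies. *)
Lemma corner_eq0 (f h : B) : f * f = f -> h * h = h ->
  (forall z, phi (f * z * h) = 0) -> forall z, f * z * h = 0.
Proof.
move=> ff hh fh0 z.
have /choice[P PP] i : exists c : 'I_n -> O, (forall j, res (c j) = 0) /\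
    f * b i * h = \sum_j alg_map B (c j) * b j.
  by have [c] := phi_ker (fh0 (b i)); exists c.
have fb0 i : f * b i * h = 0.
  apply: (nakayama (P := \matrix_(i, j) P i j) (v := fun i => f * b i * h)).
    by move=> {}i j; rewrite mxE; have [] := PP i.
  move=> {}i; transitivity (f * (f * b i * h) * h).
    by rewrite !mulrA ff -[RHS]mulrA hh.
  have [_ ->] := PP i.
  rewrite big_distrr big_distrl /=; apply: eq_bigr => j _.
  by rewrite mxE !mulrA (alg_central (P i j) f).
have [c ->] := b_span z; rewrite big_distrr big_distrl big1 //= => i _.
by rewrite mulrA -(alg_central _ f) -2!mulrA [X in _ * X]mulrA fb0 mulr0.
Qed.

(** Both off-diagonal Peirce corners of [f] vanish in the image, hence already in [B], which gives
    [f x = f x f = x f]. *)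
Lemma idem_central_of_image f : f * f = f -> (forall y, phi f * y = y * phi f) ->
  central_idempotent f.
Proof.
move=> ff cf; have f1f : f * (1 - f) = 0 by rewrite mulrBr mulr1 ff subrr.
have f1f' : (1 - f) * f = 0 by rewrite mulrBl mul1r ff subrr.
have i1f : (1 - f) * (1 - f) = 1 - f by rewrite mulrBr mulr1 f1f' subr0.
split=> // x.
have fx : f * x * (1 - f) = 0.
  apply: corner_eq0 => // z.
  by rewrite rmorphM [phi (f * z)]rmorphM cf -mulrA -rmorphM f1f rmorph0 mulr0.
have xf : (1 - f) * x * f = 0.
  apply: corner_eq0 => // z.
  by rewrite rmorphM -cf -rmorphM mulrA f1f mul0r rmorph0.
move: fx xf; rewrite mulrBr mulr1 !mulrBl mul1r => /subr0_eq fx /subr0_eq xf.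
by rewrite fx xf.
Qed.

(** The product [e1 * (1 - e2)] is a central idempotent with zero image; its corner with [h = 1]
    vanishes, so [e1 = e1 * e2]. Exchanging the roles gives equality. *)
Lemma central_idem_inj e f : central_idempotent e -> central_idempotent f ->
  phi e = phi f -> e = f.
Proof.
suff le e1 e2 : central_idempotent e1 -> central_idempotent e2 ->
    phi e1 = phi e2 -> e1 = e1 * e2.
  move=> ce cf ef; rewrite (le e f) // [RHS](le f e) //.
  by case: ce => _ ->.
move=> ce1 ce2 e12; have [gg cg] := central_idemM ce1 (central_idemC ce2).
have [ee2 _] := ce2.
have := corner_eq0 gg (mulr1 1) _ 1; rewrite !mulr1 mulrBr mulr1.
move=> /(_ _)/subr0_eq; apply=> z.
by rewrite mulr1 rmorphM rmorphB rmorphM e12 -rmorphM ee2 subrr mul0r.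
Qed.
End LocalAlgebra.

(** * Integrality over an ideal *)

Section MatrixEigenvalues.
Variables (O : comNzRingType) (L : fieldType) (eta : {rmorphism O -> L}).

(* For an ideal Q this is integrality over Q; the elements that are integral
   over Q form an ideal of the integral closure of O, by Kronecker products. *)
Definition eig (Q : O -> Prop) (x : L) : Prop :=
  exists (T : finType) (v : T -> L) (P : T -> T -> O),
    [/\ exists i, v i != 0, forall i j, Q (P i j) &
        forall i, x * v i = \sum_j eta (P i j) * v j].

Definition idealP (Q : O -> Prop) : Prop :=
  [/\ Q 0, forall a b, Q a -> Q b -> Q (a + b) & forall a b, Q a -> Q (a * b)].

Lemma eig_const (Q : O -> Prop) c : Q c -> eig Q (eta c).
Proof.
move=> Qc; exists unit, (fun=> 1), (fun _ _ => c); split=> //.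
  by exists tt; apply: oner_neq0.
by move=> i; rewrite (big_pred1 tt) // => -[].
Qed.

Variable Q : O -> Prop.
Hypothesis idQ : idealP Q.

(** The products [v i * v' j] form an eigenvector of the Kronecker sum of [P] and [P'], with
    eigenvalue [x + y]. *)
Lemma eigD x y : eig Q x -> eig Q y -> eig Q (x + y).
Proof.
have [Q0 QD QM] := idQ.
move=> [T [v [P [[i0 vi0] QP vP]]]] [T' [v' [P' [[j0 vj0] QP' vP']]]].
exists (T * T')%type, (fun u => v u.1 * v' u.2),
  (fun u w => P u.1 w.1 * (u.2 == w.2)%:R + P' u.2 w.2 * (u.1 == w.1)%:R).
split=> [|u w|[i j] /=]; first by exists (i0, j0); rewrite mulf_neq0.
  by apply: (QD); apply: QM.
rewrite -(pair_big xpredT xpredT (fun l m =>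
  eta (P i l * (j == m)%:R + P' j m * (i == l)%:R) * (v l * v' m))) /=.
under eq_bigr => l _ do under eq_bigr => m _ do rewrite rmorphD mulrDl.
under eq_bigr => l _ do rewrite big_split /=.
rewrite big_split /= mulrDl; congr (_ + _).
  rewrite mulrA vP big_distrl; apply: eq_bigr => l _ /=.
  rewrite (bigD1 j) //= eqxx mulr1 big1 ?addr0 ?mulrA // => m mj.
  by rewrite eq_sym (negPf mj) mulr0 rmorph0 mul0r.
rewrite (bigD1 i) //= [X in _ + X]big1 ?addr0 => [|l li].
  rewrite mulrCA vP' big_distrr; apply: eq_bigr => m _ /=.
  by rewrite eqxx mulr1 mulrCA.
by apply: big1 => m _; rewrite eq_sym (negPf li) mulr0 rmorph0 mul0r.
Qed.

(** Here the Kronecker product of the matrices is used; its entries lie in [Q] as soon as those of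
    one factor do, [Q] being an ideal. *)
Lemma eigM x y : eig Q x -> eig (fun=> True) y -> eig Q (x * y).
Proof.
have [_ _ QM] := idQ.
move=> [T [v [P [[i0 vi0] QP vP]]]] [T' [v' [P' [[j0 vj0] _ vP']]]].
exists (T * T')%type, (fun u => v u.1 * v' u.2),
  (fun u w => P u.1 w.1 * P' u.2 w.2).
split=> [|u w|[i j] /=]; [|exact: QM|].
  by exists (i0, j0); rewrite mulf_neq0.
rewrite -(pair_big xpredT xpredT (fun l m =>
  eta (P i l * P' j m) * (v l * v' m))) /=.
rewrite mulrACA vP vP' big_distrlr /=.
by apply: eq_bigr => l _; apply: eq_bigr => m _; rewrite rmorphM mulrACA.
Qed.

Lemma eigB x y : eig Q x -> eig Q y -> eig Q (x - y).
Proof.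
move=> Qx Qy; apply: eigD => //; rewrite -mulrN1 -(rmorphN1 eta).
by apply: eigM => //; apply: eig_const.
Qed.

Lemma eig0 : eig Q 0.
Proof. by rewrite -(rmorph0 eta); apply: eig_const; case: idQ. Qed.

(** Turns the eigenvector into a monic equation for [x]: the determinant annihilates all
    coordinates, one of which is nonzero in the field [L]. *)
Lemma eig_det x : eig Q x -> exists m (P : 'M[O]_m),
  (forall i j, Q (P i j)) /\ \det (x%:M - map_mx eta P) = 0.
Proof.
move=> [T [v [P [[i0 vi0] QP vP]]]].
exists #|T|, (\matrix_(i, j) P (enum_val i) (enum_val j)); split=> [i j|].
  by rewrite mxE.
set M := _ - _.
have := det_mul_eq0 (iota := idfun) (M := M) (v := v \o enum_val) _ (enum_rank i0).
rewrite /= enum_rankK => /(_ _)/eqP; rewrite mulf_eq0 (negPf vi0) orbF => D.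
apply/eqP/D => i.
under eq_bigr => j _ do rewrite !mxE mulrBl.
rewrite sumrB (bigD1 i) //= eqxx mulr1n big1 ?addr0 => [|j ji]; last first.
  by rewrite eq_sym (negPf ji) mulr0n mul0r.
rewrite vP (reindex_onto enum_val enum_rank) => [|j _]; last exact: enum_rankK.
by rewrite /= (eq_bigl xpredT) ?subrr // => j; rewrite enum_valK eqxx.
Qed.
End MatrixEigenvalues.

(** * Reduction of characteristic polynomials modulo the maximal ideal *)

Section ResidueOfCharPoly.
Variables (O : comNzRingType) (k : fieldType) (res : {rmorphism O -> k}).
Variables (K L : fieldType) (theta : {rmorphism O -> K}) (f : {rmorphism K -> L}).
Hypothesis theta_inj : injective theta.
Hypothesis normalO : forall m (P : 'M[O]_m) (x : K),
  \det (x%:M - map_mx theta P) = 0 -> exists c, x = theta c.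

Let eta : {rmorphism O -> L} := f \o theta.
Let m_ (c : O) : Prop := res c = 0.
Local Notation Int := (eig eta (fun=> True)).
Local Notation Im := (eig eta m_).

Lemma idealP_True : idealP (fun _ : O => True).
Proof. by []. Qed.

Lemma idealP_ker : idealP m_.
Proof.
rewrite /m_; split=> [|a b a0 b0|a b a0]; first exact: rmorph0.
  by rewrite rmorphD a0 b0 addr0.
by rewrite rmorphM a0 mul0r.
Qed.

Let iD := @eigD _ _ eta _ idealP_ker.
Let iB := @eigB _ _ eta _ idealP_ker.
Let iM := @eigM _ _ eta _ idealP_ker.

(** The determinant equation for [f x] descends to [K], since field morphisms are injective; then
    normality applies. *)
Lemma eig_descent Q x : eig eta Q (f x) -> exists c, x = theta c.
Proof.
move=> /eig_det[m [P [_ D]]]; apply: (normalO (P := P)).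
apply: (fmorph_inj f); rewrite rmorph0 -det_map_mx map_mxB map_scalar_mx.
by rewrite -map_mx_comp.
Qed.

(** The equation [det (c - P) = 0] already holds in [O]. As [P] reduces to zero, its residue says
    that a power of [res c] vanishes. *)
Lemma eig_ker_descent c : Im (eta c) -> res c = 0.
Proof.
move=> /eig_det[m [P [P0 D]]].
have : \det (c%:M - P) = 0.
  apply/theta_inj/(fmorph_inj f); rewrite !rmorph0 -!det_map_mx -map_mx_comp.
  by rewrite map_mxB map_scalar_mx.
move=> /(congr1 res); rewrite rmorph0 -det_map_mx map_mxB map_scalar_mx.
rewrite (_ : map_mx res P = 0);
  last by apply/matrixP=> i j; rewrite !mxE; exact: P0.
by rewrite subr0 det_scalar => /eqP; rewrite expf_eq0 => /andP[_ /eqP].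
Qed.

Lemma prod_XsubC_coef_int (s : seq L) : {in s, forall a, Int a} ->
  forall i, Int (\prod_(a <- s) ('X - a%:P))`_i.
Proof.
elim: s => [|a s IHs] sP i.
  rewrite big_nil coef1; case: (i == 0)%N.
    by rewrite -(rmorph1 eta); apply: eig_const.
  exact: (eig0 _ idealP_True).
have {}IHs := IHs (fun b bs => sP b (mem_behead (s := a :: s) bs)).
rewrite big_cons mulrBl coefB coefXM coefCM; apply: (eigB idealP_True).
  by case: (i == 0)%N => //; apply: (eig0 _ idealP_True).
by apply: (eigM idealP_True) => //; apply: sP; apply: mem_head.
Qed.

Lemma prod_XsubC_coef_cong (s : seq L) (g : L) : {in s, forall a, Int a} ->
  Int g -> {in s, forall a, Im (a - g)} -> forall i,
  Im ((\prod_(a <- s) ('X - a%:P))`_i - (('X - g%:P) ^+ size s)`_i).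
Proof.
elim: s => [|a s IHs] sP gP sgP i.
  by rewrite big_nil subrr; apply: (eig0 _ idealP_ker).
have sP' b : b \in s -> Int b by move=> bs; apply/sP/mem_behead.
have {}IHs := IHs sP' gP (fun b bs => sgP b (mem_behead (s := a :: s) bs)).
rewrite big_cons /= exprS !mulrBl !coefB !coefXM !coefCM.
set p := \prod_(_ <- _) _; set q := _ ^+ _.
(* Uses [a p - g q = (a - g) p + (p - q) g]. The shifted coefficient coming from multiplication by X
   is zero at index 0. *)
rewrite (_ : _ - _ = (if i == 0%N then 0 else p`_i.-1 - q`_i.-1)
   - ((a - g) * p`_i + (p`_i - q`_i) * g)); last first.
  by case: (i == 0)%N; rewrite ?subr0; ring.
apply: iB; first by case: (i == 0)%N => //; apply: (eig0 _ idealP_ker).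
apply: iD; apply: iM => //; first exact/sgP/mem_head.
exact: prod_XsubC_coef_int.
Qed.

(** Modulo the ideal, [p] is a power of [X - a0], but [a0] lies in [L] and need not come from [O].
    The constant coefficient provides an element of [O] congruent to [a0]; its residue is idempotent
    in a field, so 0 or 1. Coefficients are then compared in [L] and the congruences descended to
    [O]. *)
Lemma char_poly_residue (p : {poly K}) (a0 : L) (s : seq L) :
  a0 \in s -> map_poly f p = \prod_(a <- s) ('X - a%:P) ->
  {in s, forall a, Int a} -> {in s, forall a, Im (a - a0)} ->
  Im (a0 * a0 - a0) ->
  exists2 G : {poly O}, G \is monic /\ map_poly theta G = p &
    exists c : bool, map_poly res G = ('X - c%:R%:P) ^+ size s.
Proof.
move=> a0s pE sP sI a0I; have a0P := sP _ a0s.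
have coef_p i : f p`_i = (\prod_(a <- s) ('X - a%:P))`_i.
  by rewrite -pE coef_map.
have /choice[c cP] i : exists c, p`_i = theta c.
  by apply: (@eig_descent (fun=> True)); rewrite coef_p; apply: prod_XsubC_coef_int.
pose G := \poly_(i < size p) c i.
have GE : map_poly theta G = p.
  apply/polyP=> i; rewrite coef_map coef_poly; case: ltnP => [_|pi].
    by rewrite cP.
  by rewrite [RHS]nth_default //= rmorph0.
have pm : p \is monic.
  by rewrite -(map_monic f) pE monic_prod_XsubC.
have Gm : G \is monic.
  rewrite monicE; apply/eqP/theta_inj.
  rewrite -(lead_coef_map_inj theta_inj (rmorph0 _)) GE rmorph1.
  exact/monicP.
have etaG i : eta G`_i = (\prod_(a <- s) ('X - a%:P))`_i.
  by rewrite -coef_p -GE coef_map.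
exists G => //.
have a0X j : Im (a0 ^+ j.+1 - a0).
  elim: j => [|j IHj]; first by rewrite expr1 subrr; apply: (eig0 _ idealP_ker).
  rewrite exprSr (_ : _ - _ = (a0 ^+ j.+1 - a0) * a0 + (a0 * a0 - a0)).
    by apply: iD => //; apply: iM.
  ring.
(* Up to sign the constant coefficient is congruent to [a0 ^+ size s], and positive powers of [a0]
   are congruent to [a0]. *)
pose d : O := (-1) ^+ size s * G`_0.
have dI : Im (eta d - a0).
  have X0 : (('X - a0%:P) ^+ size s)`_0 = (-1) ^+ size s * a0 ^+ size s.
    rewrite -horner_coef0 horner_exp hornerXsubC sub0r; exact: exprNn.
  have := prod_XsubC_coef_cong sP a0P sI 0; rewrite -etaG X0 => dI.
  rewrite (_ : _ - a0 = (eta G`_0 - (-1) ^+ size s * a0 ^+ size s) *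
      eta ((-1) ^+ size s) + (a0 ^+ size s - a0)); last first.
    rewrite rmorphM /= !rmorphXn !rmorphN1.
    rewrite -[LHS](subrKA (a0 ^+ size s)) mulrBl mulrC; congr (_ - _ + _).
    by rewrite mulrAC -expr2 sqrr_sign mul1r.
  apply: iD; first by apply: iM => //; apply: eig_const.
  (* As [s] contains [a0], the exponent is positive. *)
  by case: (s) a0s => [|x t] //= _; apply: a0X.
have /eqP : res (d * d - d) = 0.
  apply: eig_ker_descent; rewrite rmorphB rmorphM.
  rewrite (_ : _ - _ = (eta d - a0) * (eta d + a0 - 1) + (a0 * a0 - a0));
    last by ring.
  apply: iD => //; apply: iM => //.
  apply: (eigB idealP_True).
    by apply: (eigD idealP_True) => //; apply: eig_const.
  by rewrite -(rmorph1 eta); apply: eig_const.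
rewrite -{3}[d]mulr1 -mulrBr rmorphM mulf_eq0 rmorphB rmorph1 subr_eq0 => dP.
have [e dE] : exists e : bool, res d = e%:R.
  by case/orP: dP => /eqP ->; [exists false | exists true].
exists e; apply/polyP=> i; rewrite coef_map.
have eE : e%:R = res e%:R by rewrite rmorph_nat.
have -> : ('X - (e%:R : k)%:P) ^+ size s = map_poly res (('X - (e%:R)%:P) ^+ size s).
  by rewrite rmorphXn rmorphB /= map_polyX map_polyC /= -eE.
apply/eqP; rewrite coef_map -subr_eq0 -rmorphB; apply/eqP/eig_ker_descent.
rewrite rmorphB etaG -[eta (_ `_ i)]coef_map rmorphXn rmorphB /= map_polyX.
rewrite map_polyC; apply: prod_XsubC_coef_cong => //; first exact: eig_const.
move=> a sa; rewrite (_ : _ - _ = (a - a0) - (eta d - a0) + eta (d - e%:R)).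
  apply: iD; first by apply: iB => //; exact: sI.
  by apply: eig_const; rewrite /m_ rmorphB dE rmorph_nat subrr.
by rewrite rmorphB /=; ring.
Qed.
End ResidueOfCharPoly.

(** * Splitting fields *)

(** A divisor of least size among those of positive degree is irreducible. *)
Lemma irreducible_factor (K : fieldType) (p : {poly K}) : (1 < size p)%N ->
  exists2 q, irreducible_poly q & q %| p.
Proof.
move=> p1; pose Q n := `[< exists q : {poly K}, [/\ size q = n, q %| p & (1 < n)%N] >].
have [n /asboolP[q [sq qp n1]] nmin] := @ex_minnP Q (ex_intro _ (size p)
  (introT (asboolP _) (ex_intro _ p (And3 erefl (dvdpp p) p1)))).
exists q => //; split=> [|r r1 rq]; first by rewrite sq.
have q0 : q != 0 by rewrite -size_poly_gt0 sq ltnW.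
have r0 : r != 0 by apply: contraNneq q0 => r0; rewrite -dvd0p -r0.
rewrite -dvdp_size_eqp // eqn_leq dvdp_leq //= sq; apply: nmin.
apply/asboolP; exists r; split=> //; first exact: dvdp_trans rq qp.
by rewrite ltn_neqAle eq_sym r1 size_poly_gt0.
Qed.

(** Induction on the size with the field varying: adjoin a root of an irreducible factor, split off
    the linear factor, and continue over the larger field. *)
Lemma splitting_ext n (K : fieldType) (p : {poly K}) : p \is monic ->
  (size p <= n.+1)%N -> exists (L : fieldType) (f : {rmorphism K -> L}) s,
    map_poly f p = \prod_(a <- s) ('X - a%:P).
Proof.
elim: n K p => [|n IHn] K p pm.
  move=> /size1_polyC pE; exists K, idfun, [::]; rewrite big_nil map_poly_id //.
  by move/monicP: pm; rewrite pE lead_coefC => ->.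
move=> sp; have [p1|p1] := leqP (size p) n.+1; first exact: IHn.
have [|q q_irr qp] := @irreducible_factor _ p; first exact: leq_trans p1.
have [L _ [z qz _]] := irredp_FAdjoin q_irr.
have /factor_theorem[r rE] : root (map_poly (in_alg L) p) z.
  by apply: root_dvdp qz; rewrite dvdp_map.
have rm : r \is monic by rewrite -(monicMr _ (monicXsubC z)) -rE map_monic.
have [|M [g [s gE]]] := IHn _ r rm.
  move: sp; rewrite -(size_map_poly (in_alg L)) rE.
  by rewrite size_Mmonic ?monicXsubC ?monic_neq0 // size_XsubC addn2.
exists M, (g \o in_alg L), (g z :: s).
rewrite map_poly_comp /= rE rmorphM rmorphB /= map_polyX map_polyC gE.
by rewrite big_cons mulrC.
Qed.

(** * Representations of finite-dimensional algebras *)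

Section Representations.
Variables (K : fieldType) (D : algebra K).

(* Row vectors: the transpose of a left representation, hence the reversal of
   products. *)
Record rep (n : nat) := Rep {
  rep_fun :> D -> 'M[K]_n;
  repD : forall x y, rep_fun (x + y) = rep_fun x + rep_fun y;
  rep1 : rep_fun 1 = 1%:M;
  repM : forall x y, rep_fun (x * y) = rep_fun y *m rep_fun x;
  rep_scalar : forall c, rep_fun (alg_map D c) = c%:M
}.

Definition repmod n (tau : rep n) : Type := 'rV[K]_n.

Section RepModule.
Variables (n : nat) (tau : rep n).
HB.instance Definition _ := GRing.Zmodule.copy (repmod tau) 'rV[K]_n.

Definition repmod_scale (x : D) (v : repmod tau) : repmod tau :=
  (v : 'rV[K]_n) *m tau x.

Lemma repmod_scaleA x y v :
  repmod_scale x (repmod_scale y v) = repmod_scale (x * y) v.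
Proof. by rewrite /repmod_scale repM mulmxA. Qed.
Lemma repmod_scale1 : left_id 1 repmod_scale.
Proof. by move=> v; rewrite /repmod_scale rep1 mulmx1. Qed.
Lemma repmod_scaleDr : right_distributive repmod_scale +%R.
Proof. by move=> x v w; rewrite /repmod_scale [LHS]mulmxDl. Qed.
Lemma repmod_scaleDl v : {morph repmod_scale^~ v : x y / x + y}.
Proof. by move=> x y; rewrite /repmod_scale repD [LHS]mulmxDr. Qed.

HB.instance Definition _ := GRing.Zmodule_isLmodule.Build D (repmod tau)
  repmod_scaleA repmod_scale1 repmod_scaleDr repmod_scaleDl.
End RepModule.

Lemma rep0 n (tau : rep n) : tau 0 = 0.
Proof. by apply: (addrI (tau 0)); rewrite -repD !addr0. Qed.

Lemma rep_sum n (tau : rep n) I (r : seq I) (F : I -> D) :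
  tau (\sum_(i <- r) F i) = \sum_(i <- r) tau (F i).
Proof. exact: (big_morph tau (@repD n tau) (rep0 tau)). Qed.

Lemma repZ n (tau : rep n) c x : tau (alg_map D c * x) = c *: tau x.
Proof. by rewrite repM rep_scalar mul_mx_scalar. Qed.

Section Scalars.
Variables (n : nat) (tau : rep n) (L : fieldType) (f : {rmorphism K -> L}).
Local Notation M := (bc_mod f (repmod tau)).
Local Notation pure s v :=
  (@tens K (restr f L^o) (restr (alg_map D) (repmod tau)) s v).

(** Under the identification of the base change of [K^n] with rows over [L], this is the pairing
    with the column [w]. These forms replace coordinates on the tensor product. *)
Definition colform (w : 'cV[L]_n) : M -> L :=
  tens_lift (fun (t : restr f L^o) (v : restr (alg_map D) (repmod tau)) =>
    (t : L) * (map_mx f (v : 'rV[K]_n) *m w) 0 0).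

Lemma colform_balanced (w : 'cV[L]_n) : balanced
  (fun (t : restr f L^o) (v : restr (alg_map D) (repmod tau)) =>
    (t : L) * (map_mx f (v : 'rV[K]_n) *m w) 0 0).
Proof.
split=> [t t' v|t v v'|r t v]; first by rewrite mulrDl.
  by rewrite (map_mxD f (v : 'rV[K]_n)) mulmxDl mxE mulrDr.
rewrite -[r *: t]/(f r * t) -[r *: v]/((v : 'rV[K]_n) *m tau (alg_map D r)).
rewrite rep_scalar mul_mx_scalar map_mxZ -scalemxAl [in RHS]mxE.
by rewrite mulrCA mulrA.
Qed.

Lemma colformD w (x y : M) : colform w (x + y) = colform w x + colform w y.
Proof. exact: (tens_liftD (colform_balanced w)). Qed.

Lemma colform_pure w t v :
  colform w (pure t v) = (t : L) * (map_mx f (v : 'rV[K]_n) *m w) 0 0.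
Proof. exact: (tens_liftE (colform_balanced w)). Qed.

Lemma colform_act w (s : L) (d : D) (y : M) :
  colform w ((@tens K (restr f L^o) (restr (alg_map D) D^o) s d : bc_ring f D)
    *: y) = s * colform (map_mx f (tau d) *m w) y.
Proof.
elim/tens_ind: y => [t v|y z IHy IHz].
  rewrite [X in colform w X](@bc_actE _ _ f D (repmod tau)) !colform_pure.
  by rewrite -[d *: _]/((v : 'rV[K]_n) *m tau d) map_mxM mulmxA mulrA.
by rewrite scalerDr !colformD IHy IHz mulrDr.
Qed.

Definition rowvect (u : 'rV[L]_n) : M :=
  \sum_j (pure (u 0 j) (delta_mx 0 j : 'rV[K]_n) : M).

Lemma colform_sum w I (r : seq I) (F : I -> M) :
  colform w (\sum_(i <- r) F i) = \sum_(i <- r) colform w (F i).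
Proof.
apply: (big_morph (colform w) (colformD w)).
by apply: (addrI (colform w 0)); rewrite -colformD !addr0.
Qed.

Lemma colform_rowvect w u : colform w (rowvect u) = (u *m w) 0 0.
Proof.
rewrite colform_sum mxE; apply: eq_bigr => j _.
by rewrite colform_pure map_delta_mx -rowE mxE.
Qed.

(** If all entries vanished, the elements whose whole orbit is killed by the form of [w] would be a
    submodule containing [u]. By simplicity it is zero, forcing [u = 0], or everything, forcing
    [w = 0]. *)
Lemma split_rep_entry (u : 'rV[L]_n) (w : 'cV[L]_n) :
  simple_module M -> u != 0 -> w != 0 ->
  exists d : D, (u *m map_mx f (tau d) *m w) 0 0 != 0.
Proof.
move=> [_ simM] u0 w0; apply: contrapT => uw0.
have {}uw0 d : (u *m map_mx f (tau d) *m w) 0 0 = 0.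
  by apply/eqP/negP=> /negP d0; apply: uw0; exists d.
pose N : {pred M} := fun y => `[< forall x : bc_ring f D, colform w (x *: y) = 0 >].
have NP y : reflect (forall x : bc_ring f D, colform w (x *: y) = 0) (y \in N).
  exact: asboolP.
have colform0 w' : colform w' 0 = 0.
  by have := colform_sum w' [::] (fun i : nat => 0); rewrite !big_nil.
have Nclosed : GRing.submod_closed N.
  split=> [|a y z /NP Ny /NP Nz]; apply/NP => x; first by rewrite scaler0.
  by rewrite scalerDr colformD Nz scalerA Ny addr0.
have uN : rowvect u \in N.
  apply/NP=> x; elim/tens_ind: x => [s d|x x' IHx IHx'].
    by rewrite colform_act colform_rowvect mulmxA uw0 mulr0.
  by rewrite scalerDl colformD IHx IHx' addr0.
have [N0|NT] := simM _ Nclosed.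
  move: uN; rewrite N0 => /eqP ue0; case/eqP: u0.
  apply/rowP=> j; have := congr1 (colform (delta_mx j 0)) ue0.
  by rewrite colform_rowvect colform0 -colE !mxE.
case/eqP: w0; apply/colP=> j.
have /NP/(_ 1) : (rowvect (delta_mx 0 j)) \in N by rewrite NT.
by rewrite scale1r colform_rowvect -rowE !mxE.
Qed.
End Scalars.
End Representations.

(** Choose [W] of maximal rank with row space inside [S]; adjoining a vector of [S] cannot raise the
    rank, so the vector already lies in [W]. *)
Lemma subspace_mx (K : fieldType) n (S : {pred 'rV[K]_n}) :
  GRing.submod_closed S -> exists W : 'M[K]_n, forall v, (v \in S) = (v <= W)%MS.
Proof.
move=> [S0 SL].
have SA (v w : 'rV_n) : v \in S -> w \in S -> v + w \in S.
  by move=> Sv Sw; rewrite -[v]scale1r; apply: SL.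
have SZ c v : v \in S -> c *: v \in S.
  by move=> Sv; rewrite -[_ *: v]addr0; apply: SL.
pose Q r := `[< exists W : 'M[K]_n, \rank W = r /\
  forall v : 'rV_n, (v <= W)%MS -> v \in S >].
have Q0 : exists r, Q r.
  exists 0; apply/asboolP; exists 0; rewrite mxrank0; split=> // v.
  by move/submx0null ->.
have Qn r : Q r -> (r <= n)%N by move=> /asboolP[W [<- _]]; apply: rank_leq_row.
have [r /asboolP[W [rW WS]] rmax] := ex_maxnP Q0 Qn.
exists W => v; apply/idP/idP => [Sv|]; last exact: WS.
have : Q (\rank (W + v)%MS).
  apply/asboolP; exists (W + v)%MS; split=> // w /sub_addsmxP[[x y] /= ->].
  apply: SA; first by apply: WS; rewrite submxMl.
  by rewrite [y]mx11_scalar mul_scalar_mx; apply: SZ.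
move/rmax; rewrite -rW (geq_leqif (mxrank_leqif_eq (addsmxSl W v))) => /andP[_].
exact: submx_trans (addsmxSr W v).
Qed.

Section RepReduction.
Variables (K : fieldType) (D : algebra K) (n : nat) (tau : rep D n).

Lemma rep_simple_or_stable : (0 < n)%N ->
  simple_module (repmod tau) \/ exists W : 'M[K]_n,
    [/\ forall x, (W *m tau x <= W)%MS, (0 < \rank W)%N & (\rank W < n)%N].
Proof.
move=> n0; apply: contrapT => /not_orP[nsim nW]; apply: nsim; split.
  exists (delta_mx 0 (Ordinal n0) : 'rV_n); apply/eqP => /rowP/(_ (Ordinal n0)).
  by rewrite !mxE !eqxx => /eqP; rewrite oner_eq0.
(* Scalars act through [alg_map D], so a submodule is a subspace, hence the row space of some
   [W]. *)
move=> S [S0 SL]; have [|W WS] := @subspace_mx K n S.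
  split=> // c v w Sv Sw.
  have := SL (alg_map D c) v w Sv Sw.
  by rewrite -[_ *: (v : repmod tau)]/((v : 'rV_n) *m tau (alg_map D c))
    rep_scalar mul_mx_scalar.
have Wst x : (W *m tau x <= W)%MS.
  apply/row_subP=> i; rewrite row_mul -WS.
  have := SL x (row i W) 0; rewrite addr0; apply=> //.
  by rewrite (WS (row i W)) row_sub.
have [rW0|rW0] := posnP (\rank W).
  left=> v; apply/idP/eqP => [|->//].
  by rewrite (WS v); move/eqP: rW0; rewrite mxrank_eq0 => /eqP -> /submx0null.
have [rWn|rWn] := ltnP (\rank W) n; first by case: nW; exists W.
by right=> v; rewrite (WS v) submx_full // /row_full eqn_leq rWn rank_leq_row.
Qed.

(** The rows of [row_base W] are a basis of the stable subspace. Being independent, they can be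
    cancelled, which yields the axioms of a representation. *)
Lemma subrep (W : 'M[K]_n) : (forall x, (W *m tau x <= W)%MS) ->
  exists sigma : rep D (\rank W),
    forall x, row_base W *m tau x = sigma x *m row_base W.
Proof.
move=> Wst; set V := row_base W.
pose s x := V *m tau x *m pinvmx V.
have sE x : V *m tau x = s x *m V.
  rewrite mulmxKpV // (submx_trans _ (_ : W <= V)%MS) ?eq_row_base //.
  apply: submx_trans (Wst x); apply: submxMr; by rewrite eq_row_base.
have Vinj (A B : 'M_(\rank W)) : A *m V = B *m V -> A = B.
  by apply: row_free_inj; apply: row_base_free.
have sD x y : s (x + y) = s x + s y.
  by apply: Vinj; rewrite mulmxDl -!sE repD mulmxDr.
have s1 : s 1 = 1%:M by apply: Vinj; rewrite -sE rep1 mulmx1 mul1mx.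
have sM x y : s (x * y) = s y *m s x.
  by apply: Vinj; rewrite -sE repM mulmxA sE -mulmxA sE mulmxA.
have sZ c : s (alg_map D c) = c%:M.
  by apply: Vinj; rewrite -sE rep_scalar mul_mx_scalar mul_scalar_mx.
by exists (Rep sD s1 sM sZ).
Qed.

(** Right multiplication by [Q] sends a row to its coordinates in the quotient by [W]: its kernel is
    the row space of [W], and [Q] can be cancelled on the left since it has full column rank. *)
Lemma quotrep (W : 'M[K]_n) : (forall x, (W *m tau x <= W)%MS) ->
  exists (sigma : rep D (n - \rank W)) (Q : 'M[K]_(n, n - \rank W)),
    (forall A : 'M_n, A *m Q = 0 -> (A <= W)%MS) /\
    forall x, tau x *m Q = Q *m sigma x.
Proof.
move=> Wst; rewrite -mxrank_coker; set Q := col_base (cokermx W).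
have QW (A : 'M_n) : (A *m Q == 0) = (A <= W)%MS.
  rewrite submxE -[X in _ = (_ *m X == _)]mulmx_base -/Q mulmxA.
  apply/eqP/eqP => [->|]; first by rewrite mul0mx.
  rewrite -[0](mul0mx _ (row_base (cokermx W))).
  by apply: row_free_inj; apply: row_base_free.
have Qfull : row_full Q by rewrite col_base_full.
clearbody Q.
pose s x := pinvmx Q *m tau x *m Q.
have sE x : tau x *m Q = Q *m s x.
  apply/eqP; rewrite /s -subr_eq0 (mulmxA Q) -mulmxBl QW.
  (* The factor [1 - Q *m pinvmx Q] is killed by [Q], so its rows lie in [W], which is stable under
     [tau x]. *)
  have -> : tau x - Q *m (pinvmx Q *m tau x) = (1%:M - Q *m pinvmx Q) *m tau x.
    by rewrite mulmxBl mul1mx mulmxA.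
  apply: submx_trans (Wst x); apply: submxMr.
  by rewrite -QW mulmxBl mul1mx -mulmxA mulVpmx // mulmx1 subrr eqxx.
have Qinj (A B : 'M_(\rank (cokermx W))) : Q *m A = Q *m B -> A = B.
  by move/(congr1 (mulmx (pinvmx Q))); rewrite !mulmxA mulVpmx // !mul1mx.
have sD x y : s (x + y) = s x + s y.
  by apply: Qinj; rewrite mulmxDr -!sE repD mulmxDl.
have s1 : s 1 = 1%:M by apply: Qinj; rewrite -sE rep1 mulmx1 mul1mx.
have sM x y : s (x * y) = s y *m s x.
  by apply: Qinj; rewrite -sE repM -mulmxA sE mulmxA sE mulmxA.
have sZ c : s (alg_map D c) = c%:M.
  by apply: Qinj; rewrite -sE rep_scalar mul_mx_scalar mul_scalar_mx.
exists (Rep sD s1 sM sZ), Q; split=> // A AQ.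
by rewrite -QW AQ eqxx.
Qed.
End RepReduction.

(* Unlike horner_morph, this does not require B to be nonzero. *)
Definition ev (O : comNzRingType) (B : pzRingType) (iota : {rmorphism O -> B})
    (a : B) (p : {poly O}) : B :=
  \sum_(i < size p) iota p`_i * a ^+ i.

Section Evaluation.
Variables (O : comNzRingType) (B : pzRingType) (iota : {rmorphism O -> B}).
Variable a : B.
Implicit Types p q : {poly O}.
Local Notation ev := (ev iota a).

Lemma ev_wide m p : (size p <= m)%N -> ev p = \sum_(i < m) iota p`_i * a ^+ i.
Proof.
move=> pm; rewrite /ev (big_ord_widen m (fun i => iota p`_i * a ^+ i)) //.
rewrite big_mkcond; apply: eq_bigr => i _.
by case: ltnP => // pi; rewrite [p`_i]nth_default // rmorph0 mul0r.
Qed.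

Lemma evD p q : ev (p + q) = ev p + ev q.
Proof.
pose m := maxn (size p) (size q).
rewrite (@ev_wide m p) ?leq_maxl // (@ev_wide m q) ?leq_maxr //.
rewrite (@ev_wide m); last exact: size_polyD.
rewrite -big_split; apply: eq_bigr => i _ /=.
by rewrite coefD rmorphD mulrDl.
Qed.

Lemma ev0 : ev 0 = 0.
Proof. by rewrite /ev size_poly0 big_ord0. Qed.

Lemma evC c : ev c%:P = iota c.
Proof.
by rewrite (@ev_wide 1) ?size_polyC_leq1 // big_ord1 coefC mulr1.
Qed.

Lemma evCM c q : ev (c%:P * q) = iota c * ev q.
Proof.
rewrite (@ev_wide (size q)); last by rewrite mul_polyC size_scale_leq.
rewrite big_distrr; apply: eq_bigr => i _ /=.
by rewrite coefCM rmorphM mulrA.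
Qed.

Lemma evMX q : ev (q * 'X) = ev q * a.
Proof.
rewrite (@ev_wide (size q).+1); last first.
  by apply: leq_trans (size_polyMleq _ _) _; rewrite size_polyX addn2.
rewrite big_ord_recl coefMX /= rmorph0 mul0r add0r big_distrl.
by apply: eq_bigr => i _ /=; rewrite coefMX /= exprSr mulrA.
Qed.

Hypothesis iota_comm : forall c, iota c * a = a * iota c.

Lemma ev_comm q : ev q * a = a * ev q.
Proof.
rewrite big_distrl big_distrr; apply: eq_bigr => i _ /=.
by rewrite -mulrA -exprSr exprS mulrA iota_comm mulrA.
Qed.

Lemma evM p q : ev (p * q) = ev p * ev q.
Proof.
elim/poly_ind: p => [|p c IHp]; first by rewrite mul0r ev0 mul0r.
rewrite mulrDl !evD evC evCM mulrDl; congr (_ + _).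
by rewrite -mulrA -commr_polyX mulrA evMX IHp -mulrA ev_comm evMX mulrA.
Qed.

Lemma evXn i : ev 'X^i = a ^+ i.
Proof.
elim: i => [|i IHi]; first by rewrite -[RHS](rmorph1 iota) -evC polyC1.
by rewrite !exprSr evMX IHi.
Qed.
End Evaluation.

Lemma ev_morph (O : comNzRingType) (B C : pzRingType) (iota : {rmorphism O -> B})
    (psi : {rmorphism B -> C}) a (p : {poly O}) :
  psi (ev iota a p) = ev (psi \o iota) (psi a) p.
Proof.
by rewrite rmorph_sum; apply: eq_bigr => i _; rewrite rmorphM rmorphXn.
Qed.

Lemma ev_map (O O' : comNzRingType) (B : pzRingType) (iota : {rmorphism O' -> B})
    (iota' : {rmorphism O -> B}) (g : {rmorphism O -> O'}) a (p : {poly O}) :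
  (forall c, iota' c = iota (g c)) -> ev iota a (map_poly g p) = ev iota' a p.
Proof.
move=> E; rewrite (@ev_wide _ _ _ _ (size p)) ?size_poly //.
by apply: eq_bigr => i _; rewrite coef_map E.
Qed.

(** * The regular representation and annihilation by characteristic polynomials *)

Section RegularRep.
Variables (K : fieldType) (D : algebra K).

Definition spans n (g : 'I_n -> D) : Prop :=
  forall x, exists c : 'I_n -> K, x = \sum_i alg_map D (c i) * g i.

(** A spanning family of least length is independent: in a relation with [c i] nonzero, [e i] can be
    eliminated. *)
Lemma exists_basis n (g : 'I_n -> D) : spans g ->
  exists m (e : 'I_m -> D), spans e /\
    forall c : 'I_m -> K, \sum_i alg_map D (c i) * e i = 0 -> forall i, c i = 0.
Proof.
move=> gS; pose Q m := `[< exists e : 'I_m -> D, spans e >].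
have [m /asboolP[e eS] mmin] :=
  @ex_minnP Q (ex_intro _ n (introT (asboolP _) (ex_intro _ g gS))).
exists m, e; split=> // c c0 i; apply: contrapT => /eqP ci.
case: m => [|m] in e eS mmin c c0 i ci *; first by case: i ci.
suff /mmin : Q m by rewrite ltnn.
apply/asboolP; exists (e \o lift i) => x; have [d ->] := eS x.
exists (fun l => d (lift i l) - d i * (c i)^-1 * c (lift i l)).
have lift_sum (F : 'I_m.+1 -> D) : \sum_l F l = F i + \sum_l F (lift i l).
  by rewrite (bigD1_ord i).
have ei : e i = - \sum_l alg_map D ((c i)^-1 * c (lift i l)) * e (lift i l).
  move: c0; rewrite lift_sum => /eqP; rewrite addr_eq0 => /eqP.
  move/(congr1 ( *%R (alg_map D (c i)^-1))).
  rewrite mulrA -rmorphM mulVf // rmorph1 mul1r mulrN big_distrr => -> /=.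
  by congr (- _); apply: eq_bigr => l _; rewrite mulrA -rmorphM.
rewrite lift_sum ei mulrN big_distrr addrC -sumrB; apply: eq_bigr => l _ /=.
by rewrite rmorphB mulrBl mulrA -rmorphM mulrA.
Qed.

(** This is the left regular representation in coordinates [co]. It is faithful because [x] is
    recovered from its action on 1. *)
Lemma exists_faithful_rep n (g : 'I_n -> D) : spans g ->
  exists m (tau : rep D m), forall x, tau x = 0 -> x = 0.
Proof.
move=> /exists_basis[m [e [eS eF]]].
have /choice[co coE] x : exists c : 'rV[K]_m, x = \sum_i alg_map D (c 0 i) * e i.
  by have [c ->] := eS x; exists (\row_i c i); apply: eq_bigr => i _; rewrite mxE.
have coU (c : 'rV_m) x : x = \sum_i alg_map D (c 0 i) * e i -> co x = c.
  move=> xE; apply/rowP=> i; apply/eqP; rewrite -subr_eq0; apply/eqP.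
  move: i; apply: (eF (fun i => co x 0 i - c 0 i)).
  under eq_bigr => i _ do rewrite rmorphB mulrBl.
  by rewrite sumrB -coE -xE subrr.
have coD x y : co (x + y) = co x + co y.
  apply: coU; rewrite {1}(coE x) {1}(coE y) -big_split; apply: eq_bigr => i _ /=.
  by rewrite mxE rmorphD mulrDl.
have coZ c x : co (alg_map D c * x) = c *: co x.
  apply: coU; rewrite {1}(coE x) big_distrr; apply: eq_bigr => i _ /=.
  by rewrite mxE rmorphM mulrA.
have co0 : co 0 = 0 by apply: (addrI (co 0)); rewrite -coD !addr0.
pose t x : 'M[K]_m := \matrix_i co (x * e i).
have tE x y : co y *m t x = co (x * y).
  rewrite {2}(coE y) big_distrr (big_morph co coD co0) mulmx_sum_row.
  apply: eq_bigr => i _ /=.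
  by rewrite rowK mulrA -alg_central -mulrA coZ.
have coe i : co (e i) = delta_mx 0 i.
  apply: coU; rewrite (bigD1 i) //= mxE !eqxx rmorph1 mul1r big1 ?addr0 //.
  by move=> l li; rewrite mxE (negPf li) andbF rmorph0 mul0r.
have t_ext (A : 'M_m) x : (forall i, co (e i) *m A = co (x * e i)) -> t x = A.
  by move=> AE; apply/row_matrixP=> i; rewrite rowK -AE coe -rowE.
have tD x y : t (x + y) = t x + t y.
  by apply: t_ext => i; rewrite mulmxDr !tE mulrDl coD.
have t1 : t 1 = 1%:M by apply: t_ext => i; rewrite mulmx1 mul1r.
have tM x y : t (x * y) = t y *m t x.
  by apply: t_ext => i; rewrite mulmxA !tE mulrA.
have tZ c : t (alg_map D c) = c%:M.
  by apply: t_ext => i; rewrite mul_mx_scalar coZ.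
exists m, (Rep tD t1 tM tZ) => x /= tx.
have := tE x 1; rewrite tx mulmx0 mulr1 => cx.
by rewrite (coE x) -cx big1 // => i _; rewrite mxE rmorph0 mul0r.
Qed.

Lemma rep_ev n (tau : rep D n) (O : comNzRingType) (theta : {rmorphism O -> K})
    x (p : {poly O}) A : tau x = A -> map_poly theta p = char_poly A ->
  tau (ev (alg_map D \o theta) x p) = 0.
Proof.
(* In size 0 all matrices are equal; the other sizes use the Cayley-Hamilton theorem. *)
case: n => [|n] in tau A *; first by move=> _ _; rewrite [LHS]flatmx0.
move=> xA pA; rewrite -(@ev_map _ _ _ (alg_map D) (alg_map D \o theta) theta) // pA.
have tX i : tau (x ^+ i) = A ^+ i.
  elim: i => [|i IHi]; first by rewrite rep1.
  by rewrite exprS repM IHi exprSr xA.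
rewrite -[RHS](Cayley_Hamilton A) rep_sum -[in RHS](coefK (char_poly A)) poly_def.
rewrite rmorph_sum; apply: eq_bigr => i _ /=.
by rewrite repZ tX horner_mxZ rmorphXn /= horner_mx_X.
Qed.
End RegularRep.

(** * Lifting central idempotents *)

Lemma col_eigenvector (L : fieldType) n (A : 'M[L]_n) a : root (char_poly A) a ->
  exists2 w : 'cV_n, w != 0 & A *m w = a *: w.
Proof.
rewrite -eigenvalue_root_char => /eigenvalueP[v vA v0].
have /det0P[w w0 wA] : \det (A - a%:M)^T == 0.
  rewrite det_tr; apply/det0P; exists v => //.
  by rewrite mulmxBr vA mul_mx_scalar subrr.
exists w^T; first by rewrite trmx_eq0.
apply/eqP; rewrite -subr_eq0 -mul_scalar_mx -mulmxBl -trmx_eq0 trmx_mul trmxK.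
by rewrite wA.
Qed.

Section IdempotentLifting.
Variables (O : comNzRingType) (k : fieldType) (res : {rmorphism O -> k}).
Hypothesis res_unit : forall c, res c != 0 -> exists d, d * c = 1.
Variables (K : fieldType) (theta : {rmorphism O -> K}).
Hypothesis theta_inj : injective theta.
Hypothesis normalO : forall m (P : 'M[O]_m) (x : K),
  \det (x%:M - map_mx theta P) = 0 -> exists c, x = theta c.
Variables (B : algebra O) (n : nat) (b : 'I_n -> B).
Hypothesis b_span :
  forall x, exists c : 'I_n -> O, x = \sum_i alg_map B (c i) * b i.
Variables (C : pzRingType) (phi : {rmorphism B -> C}) (kappa : {rmorphism k -> C}).
Hypothesis phi_ker : forall x, phi x = 0 ->
  exists2 c : 'I_n -> O, (forall i, res (c i) = 0)
    & x = \sum_i alg_map B (c i) * b i.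
Hypothesis phi_scalar : forall c, phi (alg_map B c) = kappa (res c).
Variables (D : algebra K) (j : {rmorphism B -> D}).
Hypothesis j_inj : injective j.
Hypothesis j_scalar : forall c, j (alg_map B c) = alg_map D (theta c).
Hypothesis D_span : spans (j \o b).
Hypothesis splitD : split_algebra D.

Variable a : B.
Hypothesis phi_a : central_idempotent (phi a).

Local Notation ev_B := (ev (alg_map B) a).
Local Notation ev_D := (ev (alg_map D \o theta) (j a)).

(** The reduction has no roots besides 0 and 1, and the separation of the two is already visible
    over [O]. Stability under products lets such polynomials be collected over composition
    factors. *)
Definition idem_factored (F : {poly O}) : Prop :=
  exists g h : {poly O}, [/\ F = g * h, g \is monic /\ h \is monic,
    exists i, map_poly res g = 'X^i & exists l, map_poly res h = ('X - 1) ^+ l].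

Lemma idem_factoredM F G :
  idem_factored F -> idem_factored G -> idem_factored (F * G).
Proof.
move=> [g [h [-> [gm hm] [i gi] [l hl]]]] [g' [h' [-> [gm' hm'] [i' gi'] [l' hl']]]].
exists (g * g'), (h * h'); split.
- by rewrite mulrACA.
- by split; rewrite monicMl.
- by exists (i + i')%N; rewrite rmorphM /= gi gi' exprD.
- by exists (l + l')%N; rewrite rmorphM /= hl hl' exprD.
Qed.

Section Eigenvalues.
Variables (m : nat) (tau : rep D m) (L : fieldType) (f : {rmorphism K -> L}).
Hypothesis simM : simple_module (bc_mod f (repmod tau)).
Let eta : {rmorphism O -> L} := f \o theta.

(* If u is a row and w a column eigenvector of a for y and x, then the entries
   u tau(b_i) w span a nonzero O-module of finite type in L, on which
   [a, -] acts as x - y; as [a, B] lies in mB this makes x - y integral over m. *)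
Lemma eigenvalues_congruent x y :
  root (char_poly (map_mx f (tau (j a)))) x ->
  root (char_poly (map_mx f (tau (j a)))) y ->
  [/\ eig eta (fun=> True) x, eig eta (fun c => res c = 0) (x - y) &
      eig eta (fun c => res c = 0) (x * x - x)].
Proof.
move=> /col_eigenvector[w w0 wx].
rewrite -eigenvalue_root_char => /eigenvalueP[u uy u0].
pose E (z : D) : L := (u *m map_mx f (tau z) *m w) 0 0.
have ED z z' : E (z + z') = E z + E z'.
  by rewrite /E repD map_mxD mulmxDr mulmxDl mxE.
have E0 : E 0 = 0 by apply: (addrI (E 0)); rewrite -ED !addr0.
have EZ c z : E (alg_map D c * z) = f c * E z.
  by rewrite /E repZ map_mxZ -scalemxAr -scalemxAl mxE.
have Ej c : E (j (\sum_i alg_map B (c i) * b i)) = \sum_i eta (c i) * E (j (b i)).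
  rewrite rmorph_sum (big_morph E ED E0); apply: eq_bigr => i _.
  by rewrite rmorphM /= j_scalar EZ.
have El z : E (j (a * z)) = x * E (j z).
  rewrite /E rmorphM repM map_mxM -!mulmxA wx.
  by rewrite -!scalemxAr mxE mulmxA.
have Er z : E (j (z * a)) = y * E (j z).
  by rewrite /E rmorphM repM map_mxM !mulmxA uy -!scalemxAl mxE.
(* Simplicity over [L] gives some nonzero entry; as the [j (b i)] span [D], one of them has a
   nonzero entry. *)
have [i0 Ei0] : exists i, E (j (b i)) != 0.
  have [d d0] := split_rep_entry simM u0 w0.
  apply: contrapT => nE; case/eqP: d0; have [c ->] := D_span d.
  rewrite -/(E _) (big_morph E ED E0) big1 // => i _; rewrite EZ.
  suff -> : E ((j \o b) i) = 0 by rewrite mulr0.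
  by apply/eqP/negP=> /negP Ei; apply: nE; exists i.
(* The family [E (j (b i))], nonzero at [i0], is the eigenvector required by [eig]; it remains to
   expand an element of [B] in the [b l] with coefficients in [Q]. *)
have mk (Q : O -> Prop) z :
    (forall i, exists c : 'I_n -> O, (forall l, Q (c l)) /\
      z * E (j (b i)) = E (j (\sum_l alg_map B (c l) * b l))) -> eig eta Q z.
  move=> /choice[P PP]; exists 'I_n, (fun i => E (j (b i))), P; split.
  - by exists i0.
  - by move=> i l; have [] := PP i.
  - by move=> i; rewrite -Ej; have [_ ->] := PP i.
have [aa ca] := phi_a.
split; apply: mk => i.
- by have [c ac] := b_span (a * b i); exists c; rewrite -ac El.
- have [|c c0 ac] := phi_ker (x := a * b i - b i * a).
    by rewrite rmorphB !rmorphM ca subrr.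
  by exists c; split=> //; rewrite -ac rmorphB ED -mulN1r -(rmorphN1 (alg_map D))
    EZ rmorphN1 mulN1r El Er mulrBl.
- have [|c c0 ac] := phi_ker (x := a * (a * b i) - a * b i).
    by rewrite rmorphB !rmorphM mulrA aa subrr.
  by exists c; split=> //; rewrite -ac rmorphB ED -mulN1r -(rmorphN1 (alg_map D))
    EZ rmorphN1 mulN1r !El mulrBl mulrA.
Qed.
End Eigenvalues.

(** Over a splitting field of the characteristic polynomial the module stays simple, so the
    eigenvalue congruences hold and that polynomial lifts to [O] with a reduction of the required
    form. It annihilates by Cayley-Hamilton. *)
Lemma simple_annihilator m (tau : rep D m) : (0 < m)%N ->
  simple_module (repmod tau) ->
  exists2 F, idem_factored F & tau (ev_D F) = 0.
Proof.
move=> m0 sim.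
have [L [f [s sE]]] := splitting_ext (char_poly_monic (tau (j a))) (leqnSn _).
have simM := splitD sim f.
have rootP x : x \in s -> root (char_poly (map_mx f (tau (j a)))) x.
  by rewrite -map_char_poly sE root_prod_XsubC.
(* The characteristic polynomial has positive degree [m], hence a root. *)
have [x0 x0s] : exists x, x \in s.
  case: s sE {rootP} => [|x s]; last by exists x; apply: mem_head.
  rewrite big_nil => /(congr1 (fun q : {poly L} => size q)).
  rewrite size_map_poly size_char_poly size_poly1 => -[mE].
  by rewrite mE in m0.
have [|||G [Gm Gp] [c Gc]] := char_poly_residue theta_inj normalO x0s sE (res := res).
- by move=> x /rootP rx; have [] := eigenvalues_congruent simM rx rx.
- by move=> x /rootP rx; have [] := eigenvalues_congruent simM rx (rootP _ x0s).
- by have [] := eigenvalues_congruent simM (rootP _ x0s) (rootP _ x0s).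
exists G; last exact: rep_ev Gp.
(* The lift is put entirely into the factor [h] when the common residue is 1, and into [g] when it
   is 0. *)
case: c Gc => Gc.
  exists 1, G; rewrite mul1r; split=> //; first by split=> //; apply: monic1.
    by exists 0; rewrite rmorph1.
  by exists (size s).
exists G, 1; rewrite mulr1; split=> //; first by split=> //; apply: monic1.
  by exists (size s); rewrite Gc subr0.
by exists 0; rewrite rmorph1.
Qed.

Lemma ev_D_comm c : (alg_map D \o theta) c * j a = j a * (alg_map D \o theta) c.
Proof. exact: alg_central. Qed.

(** Induction on the dimension along a stable subspace [W]: the polynomial for the quotient sends
    everything into [W], where the polynomial for [W] gives zero. *)
Lemma rep_annihilator m (tau : rep D m) :
  exists2 F, idem_factored F & tau (ev_D F) = 0.
Proof.
have [N] := ubnP m; elim: N m tau => // N IHN m tau; rewrite ltnS => mN.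
have [m0|m0] := posnP m.
  move: tau; rewrite m0 => tau; exists 1; last by rewrite [LHS]flatmx0.
  exists 1, 1; rewrite mulr1 rmorph1; split=> //.
  - by split; apply: monic1.
  - by exists 0.
  - by exists 0.
have [|[W [Wst W0 Wm]]] := rep_simple_or_stable tau m0.
  exact: simple_annihilator.
have [s1 s1E] := subrep Wst; have [s2 [Q [QW s2E]]] := quotrep Wst.
have [F1 F1f s1F] := IHN _ s1 (leq_trans Wm mN).
have [|F2 F2f s2F] := IHN _ s2.
  by apply: leq_trans mN; rewrite ltn_subrL W0 m0.
exists (F1 * F2); first exact: idem_factoredM.
rewrite (evM ev_D_comm) repM.
have /submxP[Z ->] : (tau (ev_D F2) <= row_base W)%MS.
  by rewrite eq_row_base; apply: QW; rewrite s2E s2F mulmx0.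
by rewrite -mulmxA s1E s1F mul0mx mulmx0.
Qed.

(** The resultant lies in the ideal of [g] and [h]. Leading coefficients are 1, so it reduces to the
    resultant of powers of X and X - 1, which are coprime; thus it is a unit. The successor
    exponents ensure the positive degrees that the resultant identity asks for. *)
Lemma bezout_monic (g h : {poly O}) i l : g \is monic -> h \is monic ->
  map_poly res g = 'X^(i.+1) -> map_poly res h = ('X - 1) ^+ l.+1 ->
  exists u v, u * g + v * h = 1.
Proof.
move=> gm hm gi hl.
have res_size (q : {poly O}) : q \is monic -> size (map_poly res q) = size q.
  by move=> /monicP qm; rewrite size_map_poly_id0 // qm rmorph1 oner_neq0.
have sg : (1 < size g)%N by rewrite -res_size // gi size_polyXn.
have X1 : size (('X - 1 : {poly k}) ^+ l.+1) = l.+2.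
  by rewrite -polyC1 size_exp_XsubC.
have sh : (1 < size h)%N by rewrite -res_size // hl X1.
have sP (q : {poly O}) : size (map_poly polyC q) = size q.
  by apply: size_map_inj_poly; first exact: polyC_inj.
(* Coefficients of [g] and [h] are treated as constant polynomials in an auxiliary variable; setting
   that variable to 0 returns to [O]. *)
pose ev0 : {rmorphism {poly O} -> O} := horner_eval 0.
have ev0K (q : {poly O}) : map_poly ev0 (map_poly polyC q) = q.
  rewrite -map_poly_comp map_poly_id // => c _; exact: hornerC.
have [|| [u v] /= _ uv] := @resultant_in_ideal _ (map_poly polyC g) (map_poly polyC h).
- by rewrite sP.
- by rewrite sP.
set r := resultant _ _ in uv.
have resK (q : {poly O}) : map_poly (res \o ev0) (map_poly polyC q) = map_poly res q.
  by rewrite map_poly_comp /= ev0K.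
have r0 : res (ev0 r) != 0.
  have lead1 (q : {poly O}) : q \is monic ->
      (res \o ev0) (lead_coef (map_poly polyC q)) != 0.
    move=> qm; rewrite lead_coef_map_inj //; last exact: polyC_inj.
    by rewrite (monicP qm) rmorph1 oner_neq0.
  rewrite -[res (ev0 r)]/((res \o ev0) r) map_resultant ?lead1 //.
  rewrite !resK resultant_eq0 gi hl -leqNgt leq_eqVlt -coprimep_def coprimep_expl //.
  by rewrite coprimep_expr // -polyC1 coprimep_XsubC rootX oner_neq0.
have [d dr] := res_unit r0.
exists (d%:P * map_poly ev0 u), (d%:P * map_poly ev0 v).
rewrite -!mulrA -mulrDr -{1}(ev0K g) -{1}(ev0K h) -!rmorphM -rmorphD -uv.
by rewrite /= map_polyC -polyCM dr.
Qed.

Lemma lift_central_idem : exists2 e, central_idempotent e & phi e = phi a.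
Proof.
have [m [tau tau0]] := exists_faithful_rep D_span.
have [F [g [h [FE [gm hm] [i gi] [l hl]]]] /tau0 F0] := rep_annihilator tau.
(* The extra factors make both degrees positive and make the reductions absorb, respectively
   annihilate, the idempotent [phi a]. *)
pose g' := g * 'X; pose h' := h * ('X - 1).
have gi' : map_poly res g' = 'X^(i.+1) by rewrite rmorphM /= gi map_polyX exprSr.
have hl' : map_poly res h' = ('X - 1) ^+ l.+1.
  by rewrite rmorphM rmorphB rmorph1 /= hl map_polyX exprSr.
have [||u [v uv]] := bezout_monic _ _ gi' hl'.
- by rewrite monicMl // monicX.
- by rewrite monicMl // -polyC1 monicXsubC.
have ac c : alg_map B c * a = a * alg_map B c by exact: alg_central.
have gh0 : ev_B (g' * h') = 0.
  rewrite mulrACA -FE (evM ac); suff -> : ev_B F = 0 by rewrite mul0r.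
  apply: j_inj; rewrite rmorph0 ev_morph -F0.
  by apply: eq_bigr => q _ /=; rewrite j_scalar.
have phi_ev p : phi (ev_B p) = ev kappa (phi a) (map_poly res p).
  by rewrite ev_morph (ev_map (iota' := phi \o alg_map B)).
have kc c : kappa c * phi a = phi a * kappa c by case: phi_a => _ ->.
have [aa ca] := phi_a.
pose e := ev_B (u * g').
have eE : 1 - e = ev_B (v * h').
  have <- : ev_B 1 = 1 by rewrite -polyC1 evC rmorph1.
  by rewrite -uv evD addrC addKr.
(* The product [e * (1 - e)] is a multiple of [ev_B (g' * h')], which is zero. *)
have ee : e * e = e.
  apply/eqP; rewrite -subr_eq0 -{3}[e]mulr1 -mulrBr -opprB mulrN oppr_eq0; apply/eqP.
  rewrite eE -(evM ac) mulrACA (evM ac) gh0 mulr0 //.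
(* [phi e] is a multiple of a positive power of [phi a], and [phi (1 - e)] of a positive power of
   [phi a - 1]; idempotence of [phi a] then yields [phi e = phi a]. *)
have ea : phi a * phi e = phi e.
  rewrite /e (evM ac) rmorphM [phi (ev_B g')]phi_ev gi' evXn exprSr.
  by rewrite ca -!mulrA aa.
have e1a : phi (1 - e) * phi a = 0.
  rewrite eE (evM ac) rmorphM [phi (ev_B h')]phi_ev hl' exprSr (evM kc).
  rewrite -2!mulrA -polyC1 -polyCN evD evC -['X]expr1 evXn expr1.
  rewrite [kappa _]rmorphN rmorph1.
  by rewrite mulrDl aa mulN1r subrr !mulr0.
have phie : phi e = phi a.
  by rewrite -ea ca; move: e1a; rewrite rmorphB rmorph1 mulrBl mul1r => /subr0_eq.
exists e => //.
apply: (idem_central_of_image res_unit b_span phi_ker ee).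
by rewrite phie.
Qed.
End IdempotentLifting.

(** * Localization, fiber and generic fiber *)

Section BaseChangeSpan.
Variables (R S : comNzRingType) (f : {rmorphism R -> S}) (A : algebra R).
Local Notation pure s a :=
  (@tens R (restr f S^o) (restr (alg_map A) A^o) s a : bc_alg f A).

Lemma bc_map_pure c s a : alg_map (bc_alg f A) c * pure s a = pure (c * s) a.
Proof.
rewrite [LHS](@bc_actE _ _ f A A^o).
by rewrite -[_ *: _]/(_ * _ : A) mul1r.
Qed.

Lemma tensor_sumr I (r : seq I) (F : I -> alg_mod A) s :
  pure s (\sum_(i <- r) F i) = \sum_(i <- r) pure s (F i).
Proof.
apply: (big_morph (fun a => pure s a)) => [a b|]; first exact: tensDr.
by apply: (addrI (pure s 0)); rewrite -[LHS]tensDr !addr0.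
Qed.

Lemma bc_span (s : seq (alg_mod A)) :
  (forall x, exists c : nat -> R, x = \sum_(i < size s) c i *: s`_i) ->
  forall x : bc_alg f A, exists c : 'I_(size s) -> S,
    x = \sum_i alg_map (bc_alg f A) (c i) * pure 1 s`_i.
Proof.
move=> sP; elim/tens_ind=> [t a|_ _ [c ->] [d ->]]; last first.
  exists (fun i => c i + d i); rewrite -[LHS]big_split; apply: eq_bigr => i _ /=.
  by rewrite rmorphD mulrDl.
have [c ->] := sP a; exists (fun i => f (c i) * t).
rewrite [LHS](tensor_sumr _ _ t); apply: eq_bigr => i _.
by rewrite bc_map_pure mulr1 -tensZ.
Qed.
End BaseChangeSpan.

Section Localization.
Variables (R : idomainType) (p : prime_idealr R).
Local Notation O := (localization p).
Local Notation K := {fraction R}.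
Local Notation res := (@loc_to_res R p).

Definition loc_to_frac : {rmorphism O -> K} := val.

Lemma loc_res_unit (c : O) : res c != 0 -> exists d, d * c = 1.
Proof.
have [[a s] /= [sp cE]] := loc_frac c.
rewrite (loc_to_resE sp cE) mulf_eq0 negb_or to_res_eq0 => /andP[ap _].
have dP : tofrac s / tofrac a \in @in_loc R p by apply/in_locP; exists s, a.
exists (Localization dP); apply: val_inj; rewrite /= cE.
rewrite mulf_div [in X in _ / X]mulrC divff // mulf_neq0 ?tofrac_eq0 //.
  exact: notin_prime_neq0 sp.
exact: notin_prime_neq0 ap.
Qed.

Lemma loc_common_denom (T : finType) (c : T -> O) : exists2 s, s \notin p &
  forall t, exists r, tofrac s * val (c t) = tofrac r :> K.
Proof.
have /choice[u uP] t := loc_frac (c t).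
exists (\prod_t (u t).2) => [|t].
  elim/big_ind: _ => [|x y xp yp|t _]; [by rewrite idealr1| exact: notin_primeM |].
  by have [] := uP t.
have [tp ->] := uP t; rewrite (bigD1 t) //= rmorphM mulrC.
exists ((u t).1 * \prod_(i | i != t) (u i).2); rewrite rmorphM mulrA divfK //.
by rewrite tofrac_eq0 (notin_prime_neq0 tp).
Qed.

(** Clearing a common denominator [s] of [P] makes [s x] an eigenvalue of a matrix over [R]. It is
    integral over [R], hence in [R], and [s] is invertible in the localization. *)
Lemma loc_normal : normal_domain R -> forall m (P : 'M[O]_m) (x : K),
  \det (x%:M - map_mx loc_to_frac P) = 0 -> exists c, x = loc_to_frac c.
Proof.
move=> nR m P x Px.
have [s sp] := loc_common_denom (fun ij : 'I_m * 'I_m => P ij.1 ij.2).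
move=> /choice[q qP]; have s0 := notin_prime_neq0 sp.
have [|r rE] := nR (tofrac s * x).
  exists (char_poly (\matrix_(i, j) q (i, j))); first exact: char_poly_monic.
  rewrite map_char_poly -eigenvalue_root_char.
  have /eqP/det0P[v v0 vP] := Px.
  apply/eigenvalueP; exists v => //; rewrite -scalerA.
  have /eqP := vP; rewrite mulmxBr subr_eq0 mul_mx_scalar => /eqP ->.
  rewrite scalemxAr; congr (_ *m _).
  by apply/matrixP=> i l; rewrite !mxE; exact: esym (qP (i, l)).
have xP : x \in @in_loc R p.
  by apply/in_locP; exists r, s; split; rewrite // -rE mulrAC divff ?mul1r ?tofrac_eq0.
by exists (Localization xP).
Qed.
End Localization.

(** * The kernel of the specialization map *)

Section Specialization.
Variables (R : idomainType) (p : prime_idealr R) (A : algebra R).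
Local Notation O := (localization p).
Local Notation K := {fraction R}.
Local Notation res := (@loc_to_res R p).
Local Notation B := (alg_loc p A).
Local Notation D := (bc_alg (@tofrac R) A).
Local Notation pureB s a :=
  (@tens R (restr (@to_loc R p) O^o) (restr (alg_map A) A^o) s a : B).
Local Notation pureD s a :=
  (@tens R (restr (@tofrac R) K^o) (restr (alg_map A) A^o) s a : D).

Section Kernel.
Variables (n : nat) (b : 'I_n -> B).
Hypothesis b_span :
  forall x, exists c : 'I_n -> O, x = \sum_i alg_map B (c i) * b i.

Definition in_maxB (x : B) : Prop := exists2 c : 'I_n -> O,
  forall i, res (c i) = 0 & x = \sum_i alg_map B (c i) * b i.

Lemma in_maxB0 : in_maxB 0.
Proof.
exists (fun=> 0) => [i|]; first exact: rmorph0.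
by rewrite big1 // => i _; rewrite rmorph0 mul0r.
Qed.

Lemma in_maxBD x y : in_maxB x -> in_maxB y -> in_maxB (x + y).
Proof.
move=> [c c0 ->] [d d0 ->]; exists (fun i => c i + d i) => [i|].
  by rewrite rmorphD /= c0 d0 addr0.
by rewrite -big_split; apply: eq_bigr => i _ /=; rewrite rmorphD mulrDl.
Qed.

Lemma in_maxBN x : in_maxB x -> in_maxB (- x).
Proof.
move=> [c c0 ->]; exists (fun i => - c i) => [i|].
  by rewrite rmorphN /= c0 oppr0.
by rewrite -sumrN; apply: eq_bigr => i _ /=; rewrite rmorphN mulNr.
Qed.

Lemma in_maxB_pure t a : res t = 0 -> in_maxB (pureB t a).
Proof.
move=> t0; have [c cE] := b_span (pureB 1 a).
exists (fun i => t * c i) => [i|]; first by rewrite rmorphM /= t0 mul0r.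
have -> : pureB t a = alg_map B t * pureB 1 a by rewrite bc_map_pure mulr1.
rewrite cE big_distrr; apply: eq_bigr => i _ /=.
by rewrite rmorphM mulrA.
Qed.

(** A set-theoretic section [lift] of the residue map induces [g] on formal sums over the fiber. It
    is not additive, but each tensor relation changes [g] only by an element of mB. A formal sum
    that is zero in the fiber therefore has its image under [g] in mB. *)
Lemma specialization_ker x : specialization p A x = 0 -> in_maxB x.
Proof.
move=> x0; have /choice[lift liftK] := @loc_to_res_surj R p.
pose g (s : seq (res_field p * A)) : B := \sum_(u <- s) pureB (lift u.1) u.2.
have gP s t : @tens_rel R (restr (@to_res R p) (res_field p)^o) (alg_mod A) s t ->
    in_maxB (g s - g t).
  elim=> {s t}.
  - by move=> s; rewrite subrr; apply: in_maxB0.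
  - by move=> s t _ IH; rewrite -opprB; apply: in_maxBN.
  - by move=> s t u _ IH _ IH'; rewrite -(subrKA (g t)); apply: in_maxBD.
  - by move=> s s' t t' _ IH _ IH'; rewrite /g !big_cat opprD addrACA; apply: in_maxBD.
  - by move=> s t; rewrite /g !big_cat /= addrC subrr; apply: in_maxB0.
  - move=> a; rewrite /g big_seq1 big_nil subr0; apply: in_maxB_pure.
    exact: liftK.
  - move=> m m' a; rewrite /g !big_cons !big_nil !addr0 /=.
    have -> : pureB (lift (m + m')) a - (pureB (lift m) a + pureB (lift m') a) =
        pureB (lift (m + m') - (lift m + lift m')) a.
      apply/eqP; rewrite subr_eq -[pureB (lift m) a + _]tensDl.
      by rewrite -[X in _ == X]tensDl subrK.
    apply: in_maxB_pure; rewrite rmorphB rmorphD /= !liftK; exact: subrr.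
  - move=> m a a'; rewrite /g !big_cons !big_nil !addr0 /=.
    rewrite -[pureB (lift m) a + _]tensDr subrr; exact: in_maxB0.
  - move=> r m a; rewrite /g !big_seq1 /= -tensZ.
    set m' := r *: m; set l := r *: _.
    have -> : pureB (lift m') a - pureB l a = pureB (lift m' - l) a.
      by apply/eqP; rewrite subr_eq -[X in _ == X]tensDl subrK.
    apply: in_maxB_pure; rewrite rmorphB /= liftK /l.
    rewrite -[r *: _]/(to_loc p r * lift m) rmorphM /= liftK loc_to_res_to_loc.
    exact: subrr.
pose s := repr (x : tensor _ _).
have xE : x = \sum_(u <- s) pureB u.1 u.2 by rewrite -[LHS]reprK tens_pi.
pose t := [seq (res u.1 : res_field p, u.2 : A) | u <- s].
have /gP : @tens_rel R (restr (@to_res R p) (res_field p)^o) (alg_mod A) t [::].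
  apply/tens_piP; rewrite tens_pi big_map; transitivity (specialization p A x).
    by rewrite xE rmorph_sum; apply: eq_bigr => u _; rewrite /= specializationE.
  by rewrite x0 tens_pi big_nil.
rewrite /g big_nil subr0 big_map /= => gx.
(* Replacing each coefficient by the chosen lift of its residue changes [x] by an element of mB. *)
rewrite -[x](subrK (\sum_(u <- s) pureB (lift (res u.1)) u.2)).
apply: in_maxBD => //; rewrite xE -sumrB.
elim/big_ind: _ => [|y z|u _]; [exact: in_maxB0 | exact: in_maxBD |].
have -> : pureB u.1 u.2 - pureB (lift (res u.1)) u.2 = pureB (u.1 - lift (res u.1)) u.2.
  by apply/eqP; rewrite subr_eq -[X in _ == X]tensDl subrK.
by apply: in_maxB_pure; rewrite rmorphB /= liftK subrr.
Qed.
End Kernel.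
End Specialization.

Section Swap.
Variables (R : comPzRingType) (M N : lmodType R).

(** Bridges two conventions: [flat] has the module as the left tensor factor, base change as the
    right one. *)
Definition tens_swap : tensor M N -> tensor N M :=
  tens_lift (fun m n => tens n m).

Lemma tens_swap_balanced : balanced (fun (m : M) (n : N) => tens n m).
Proof. by split=> *; rewrite ?tensDl ?tensDr ?tensZ. Qed.

Lemma tens_swapE m n : tens_swap (tens m n) = tens n m.
Proof. exact: tens_liftE tens_swap_balanced m n. Qed.

Lemma tens_swapD x y : tens_swap (x + y) = tens_swap x + tens_swap y.
Proof. exact: tens_liftD tens_swap_balanced x y. Qed.
End Swap.

Lemma tens_swapK (R : comPzRingType) (M N : lmodType R) :
  cancel (@tens_swap R M N) (@tens_swap R N M).
Proof.
elim/tens_ind=> [m n|x y IHx IHy]; first by rewrite !tens_swapE.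
by rewrite !tens_swapD IHx IHy.
Qed.

(** * The map from the localization to the generic fiber *)

Section GenericFiber.
Variables (R : idomainType) (p : prime_idealr R) (A : algebra R).
Local Notation O := (localization p).
Local Notation K := {fraction R}.
Local Notation B := (alg_loc p A).
Local Notation D := (bc_alg (@tofrac R) A).
Local Notation OM := (restr (@to_loc R p) O^o).
Local Notation KM := (restr (@tofrac R) K^o).

Definition loc_incl (x : OM) : KM := loc_val (x : O).

Lemma loc_incl_zmod : zmod_morphism loc_incl.
Proof. by []. Qed.

Lemma loc_incl_scalable : scalable loc_incl.
Proof. by []. Qed.

HB.instance Definition _ := GRing.isZmodMorphism.Build OM KM loc_incl loc_incl_zmod.
HB.instance Definition _ :=
  GRing.isScalable.Build R OM KM *:%R loc_incl loc_incl_scalable.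

Definition generic_fiber : B -> D := tens_map loc_incl (idlin (alg_mod A)).

Lemma generic_fiber_pure (x : O) a :
  generic_fiber (@tens R OM (alg_mod A) x a) = @tens R KM (alg_mod A) (loc_val x) a.
Proof. exact: (tens_mapE loc_incl (idlin (alg_mod A))). Qed.

Lemma generic_fiberD x y :
  generic_fiber (x + y) = generic_fiber x + generic_fiber y.
Proof. exact: (tens_liftD (tens_map_balanced loc_incl (idlin (alg_mod A)))). Qed.

Lemma generic_fiber_zmod : zmod_morphism generic_fiber.
Proof.
by move=> x y; apply: (addIr (generic_fiber y)); rewrite subrK -generic_fiberD subrK.
Qed.

Lemma generic_fiber_monoid : monoid_morphism generic_fiber.
Proof.
split; first exact: generic_fiber_pure.
move=> x y; elim/tens_ind: x => [s a|x x' IHx IHx'].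
  elim/tens_ind: y => [t b|y y' IHy IHy'].
    rewrite [X in generic_fiber X](@bc_actE _ _ (@to_loc R p) A A^o).
    by rewrite !generic_fiber_pure [RHS](@bc_actE _ _ (@tofrac R) A A^o).
  by rewrite [in LHS]mulrDr !generic_fiberD mulrDr IHy IHy'.
by rewrite [in LHS]mulrDl !generic_fiberD mulrDl IHx IHx'.
Qed.

HB.instance Definition _ :=
  GRing.isZmodMorphism.Build B D generic_fiber generic_fiber_zmod.
HB.instance Definition _ :=
  GRing.isMonoidMorphism.Build B D generic_fiber generic_fiber_monoid.

(** Up to swapping factors this map is obtained by tensoring the inclusion of the localization into
    the fraction field with [A], so flatness preserves injectivity. *)
Lemma generic_fiber_inj : flat (alg_mod A) -> injective generic_fiber.
Proof.
move=> flatA.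
have incl_inj : injective loc_incl by move=> x y /val_inj.
have swapE (x : B) : generic_fiber x =
    tens_swap (tens_map (idlin (alg_mod A)) loc_incl (tens_swap x)).
  elim/tens_ind: x => [x a|x y IHx IHy].
    by rewrite tens_swapE tens_mapE tens_swapE; exact: generic_fiber_pure.
  rewrite generic_fiberD IHx IHy -tens_swapD; congr (tens_swap _).
  rewrite tens_swapD; apply: esym.
  exact: (tens_liftD (tens_map_balanced (idlin (alg_mod A)) loc_incl)).
have swap_inj (M N : lmodType R) : injective (@tens_swap R M N).
  exact: can_inj (@tens_swapK R M N).
move=> x y xy; apply: (swap_inj OM (alg_mod A)); apply: flatA incl_inj _ _ _.
by apply: (swap_inj (alg_mod A) KM); rewrite -!swapE.
Qed.
End GenericFiber.

Theorem theorem1p1 (R : idomainType) (A : algebra R)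
  (noethR : noetherian R) (normalR : normal_domain R)
  (fgA : fin_gen_module (alg_mod A)) (flatA : flat (alg_mod A))
  (splitAK : split_algebra (bc_alg (@tofrac R) A)) :
  forall p : prime_idealr R, block_bijective (specialization p A).
Proof.
move=> p; have [s sP] := fgA.
have sgen x : exists c : nat -> R, x = \sum_(i < size s) c i *: s`_i.
  by apply/sP.
have B_span := bc_span (f := @to_loc R p) sgen.
have D_span := bc_span (f := @tofrac R) sgen.
have phi_ker := specialization_ker B_span.
have phi_surj := @specialization_surj R p A.
apply: block_bijective_of_central_idem => // [e f|y yc].
  exact: (central_idem_inj (@loc_res_unit R p) B_span phi_ker).
(* Any preimage of the central idempotent will do; it need be neither central nor idempotent. *)
have [a aE] := phi_surj y; rewrite -aE in yc *.
have jM c : generic_fiber (alg_map (alg_loc p A) c) =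
    alg_map (bc_alg (@tofrac R) A) (loc_to_frac p c).
  exact: generic_fiber_pure.
have phiM c : specialization p A (alg_map (alg_loc p A) c) =
    alg_map (alg_fiber p A) (loc_to_res c).
  exact: specializationE.
apply: (lift_central_idem (@loc_res_unit R p) val_inj (loc_normal normalR) B_span
  phi_ker phiM (@generic_fiber_inj R p A flatA) jM _ splitAK yc).
(* What remains is that the generators of the localization have images spanning the generic fiber:
   both families come from the same generators of [A]. *)
move=> x; have [c ->] := D_span x; exists c; apply: eq_bigr => i _.
by congr (_ * _); rewrite /= generic_fiber_pure.
Qed.
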